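(* Let $p\ge 2$ and $\lambda>0$, let $n\in\mathbb{N}$, and let $\boldsymbol{X}_1,\dots,\boldsymbol{X}_n$ be iid random vectors on $\mathcal{S}^{p-1}$. Let $$T_n(\lambda)=n\Big\|\frac1n\sum_{j=1}^n\Delta_{\mathcal{S}^{p-1}}e^{\lambda\boldsymbol{t}^\top\boldsymbol{X}_j}\Big\|^2_{L^2(\mathcal{S}^{p-1})}.$$ Then $T_n(\lambda)$ has the harmonic decomposition $$T_n(\lambda)=\frac1n\sum_{i,j=1}^n\sum_{k=1}^\infty c_{k,p}(\lambda)\,C_k^{(p-2)/2}(\boldsymbol{X}_i^\top\boldsymbol{X}_j),\qquad c_{k,p}(\lambda):=\big(m_{k,p}(\lambda)\,k(k+p-2)\big)^2\gamma_{k,p},\quad k\in\mathbb{N},$$ where the coefficients are explicitly given by $$c_{k,p}(\lambda)=\begin{cases}2k^4\,\mathcal{I}_k(\lambda)^2,&p=2,\\[2pt] 2^{p-3}\lambda^{2-p}(p-2)\big(k+\tfrac{p-2}{2}\big)\Big(\Gamma\big(\tfrac{p-2}{2}\big)\,k(k+p-2)\,\mathcal{I}_{(p-2)/2+k}(\lambda)\Big)^2,&p>2.\end{cases}$$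
   Context: $\mathcal{S}^{p-1}=\{\boldsymbol{x}\in\mathbb{R}^p:\|\boldsymbol{x}\|=1\}$; $\nu_{p-1}$ is the uniform probability measure on $\mathcal{S}^{p-1}$; $L^2(\mathcal{S}^{p-1})$ has inner product $\langle h,k\rangle=\int_{\mathcal{S}^{p-1}}hk\,\mathrm{d}\nu_{p-1}$. $\Delta_{\mathcal{S}^{p-1}}$ is the Laplace--Beltrami operator on $\mathcal{S}^{p-1}$; $\Delta_{\mathcal{S}^{p-1}}e^{\lambda\boldsymbol{t}^\top\boldsymbol{X}_j}$ is it applied to $\boldsymbol{x}\mapsto e^{\lambda\boldsymbol{t}^\top\boldsymbol{x}}$ and evaluated at $\boldsymbol{x}=\boldsymbol{X}_j$ (equivalently, applied in $\boldsymbol{t}$), and the $L^2(\mathcal{S}^{p-1})$ norm is taken with respect to $\boldsymbol{t}\in\mathcal{S}^{p-1}$. For $p\ge3$, $C_k^{(p-2)/2}$ is the Gegenbauer polynomial of degree $k$ and index $(p-2)/2$ (standard normalization); for $p=2$, $C_k^{0}(u):=\cos(k\arccos u)$ is the Chebyshev polynomial. With $\langle f,g\rangle_{L^{2,p}}=\int_{-1}^1f(u)g(u)(1-u^2)^{(p-3)/2}\,\mathrm{d}u$, $$m_{k,p}(\lambda):=\frac{\langle e^{\lambda\,\cdot},C_k^{(p-2)/2}\rangle_{L^{2,p}}}{\|C_k^{(p-2)/2}\|^2_{L^{2,p}}},\quad k\in\mathbb{N}_0,$$ i.e. $e^{\lambda u}=\sum_{k=0}^\infty m_{k,p}(\lambda)C_k^{(p-2)/2}(u)$,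 $u\in[-1,1]$. Explicitly, $m_{k,2}(\lambda)=(2-1_{\{k=0\}})\mathcal{I}_k(\lambda)$ and, for $p>2$, $m_{k,p}(\lambda)=(2/\lambda)^{(p-2)/2}\Gamma(\tfrac{p-2}{2})(k+\tfrac{p-2}{2})\mathcal{I}_{(p-2)/2+k}(\lambda)$, where $\mathcal{I}_\alpha$ is the modified Bessel function of the first kind of order $\alpha$. Finally, $\gamma_{k,2}=(1+1_{\{k=0\}})/2$ and $\gamma_{k,p}=(p-2)/(2k+p-2)$ for $p>2$. *)

(* Defs.v *)
From HB Require Import structures.
From mathcomp Require Import all_boot all_order all_algebra.
From mathcomp Require Import all_classical all_reals all_analysis.

Set Implicit Arguments.
Unset Strict Implicit.
Unset Printing Implicit Defensive.

Import Order.TTheory GRing.Theory Num.Theory.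
Import numFieldNormedType.Exports.

Local Open Scope classical_set_scope.
Local Open Scope ring_scope.

(* R^p with its Borel sigma-algebra. *)
Notation borelRV R p := (g_sigma_algebraType (@open 'rV[R]_p)).

Section Sphere.
Context {R : realType} {p : nat}.
Implicit Types x y : 'rV[R]_p.

(* The library norm on 'rV[R]_p is the sup norm, hence a separate Euclidean
   norm. *)
Definition dot x y : R := \sum_i x ord0 i * y ord0 i.

Definition enorm x : R := Num.sqrt (dot x x).

Definition sphere : set 'rV[R]_p := [set x | enorm x = 1].

(* The uniform distribution on the sphere is the (unique) Borel probability
   measure carried by it that is invariant under all orthogonal maps. *)
Definition uniform_on_sphere (nu : probability (borelRV R p) R) : Prop :=
  nu sphere = 1%E /\
  forall (Q : 'M[R]_p) (A : set (borelRV R p)), Q *m Q^T = 1%:M ->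
    measurable A -> nu [set x | A (x *m Q)] = nu A.

Definition laplacian (f : 'rV[R]_p -> R) : 'rV[R]_p -> R :=
  fun x => \sum_(i < p)
    'D_(delta_mx ord0 i) (fun y => 'D_(delta_mx ord0 i) f y) x.

(* The Laplace--Beltrami operator of the sphere at a point x of the sphere:
   the Euclidean Laplacian at x of the extension of f that is homogeneous of
   degree 0. Only the values of f on the sphere matter. *)
Definition laplace_beltrami (f : 'rV[R]_p -> R) : 'rV[R]_p -> R :=
  laplacian (fun y => f ((enorm y)^-1 *: y)).

Variable nu : probability (borelRV R p) R.

Definition sphere_ip (h k : 'rV[R]_p -> R) : R :=
  \int[nu]_(t in (sphere : set (borelRV R p))) (h t * k t).

Definition sphere_L2norm (h : 'rV[R]_p -> R) : R := Num.sqrt (sphere_ip h h).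

Definition Tstat (lambda : R) (n : nat) (x : 'I_n -> 'rV[R]_p) : R :=
  n%:R * (sphere_L2norm (fun t => n%:R^-1 *
    \sum_(j < n) laplace_beltrami (fun y => expR (lambda * dot t y)) (x j)))
  ^+ 2.

End Sphere.

Arguments sphere R p : clear implicits.

Section Iid.
Context d (Omega : measurableType d) d' (T : measurableType d') (R : realType).
Context (P : probability Omega R) (n : nat).

Definition mutually_independent (X : 'I_n -> {RV P >-> T}) : Prop :=
  forall (J : {set 'I_n}) (B : 'I_n -> set T),
    (forall j, measurable (B j)) ->
    P (\bigcap_(j in [set` J]) (X j @^-1` B j)) =
    (\prod_(j in J) P (X j @^-1` B j))%E.

Definition identically_distributed (X : 'I_n -> {RV P >-> T}) : Prop :=
  forall (i j : 'I_n) (B : set T), measurable B ->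
    distribution P (X i) B = distribution P (X j) B.

Definition iid (X : 'I_n -> {RV P >-> T}) : Prop :=
  mutually_independent X /\ identically_distributed X.

End Iid.

Section SpecialFunctions.
Context {R : realType}.

(* Gegenbauer polynomials in the standard normalization, by
   (k+2) C_{k+2} = 2 (k+1+a) X C_{k+1} - (k+2a) C_k. *)
Fixpoint gegenbauer (a : R) (k : nat) : {poly R} :=
  match k with
  | 0 => 1
  | 1 => (2 * a) *: 'X
  | (k''.+1 as k').+1 =>
      (k''.+2)%:R^-1 *:
        ((2 * (k''.+1%:R + a)) *: ('X * gegenbauer a k')
         - (k''%:R + 2 * a) *: gegenbauer a k'')
  end.

(* C_k^{(p-2)/2}, with the convention that the index 0 denotes the Chebyshev
   polynomials (the recurrence above would give 0 for k > 0). *)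
Definition gegC (p k : nat) (u : R) : R :=
  if p == 2%N then cos (k%:R * acos u)
  else (gegenbauer ((p%:R - 2) / 2) k).[u].

(* For p = 2 the weight is singular at -1 and 1, where `^ takes the value 0;
   these two points are Lebesgue negligible. *)
Definition ipL2p (p : nat) (f g : R -> R) : R :=
  \int[@lebesgue_measure R]_(u in `[(-1)%R, 1%R])
    (f u * g u * (1 - u ^+ 2) `^ ((p%:R - 3) / 2)).

Definition m_coef (p k : nat) (lambda : R) : R :=
  ipL2p p (fun u => expR (lambda * u)) (gegC p k)
  / ipL2p p (gegC p k) (gegC p k).

Definition gamma_coef (p k : nat) : R :=
  if p == 2%N then (1 + (k == 0%N)%:R) / 2
  else (p%:R - 2) / (2 * k%:R + p%:R - 2).

Definition c_coef (p k : nat) (lambda : R) : R :=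
  (m_coef p k lambda * (k%:R * (k%:R + p%:R - 2))) ^+ 2 * gamma_coef p k.

(* Euler's Gamma function at x > 0. *)
Definition Gamma (x : R) : R :=
  \int[@lebesgue_measure R]_(t in `]0%R, +oo[) (t `^ (x - 1) * expR (- t)).

(* Modified Bessel function of the first kind, of order a >= 0, at x > 0. *)
Definition besselI (a x : R) : R :=
  \big[+%R/0]_(0 <= j <oo)
    ((x / 2) `^ (2 * j%:R + a) / (j`!%:R * Gamma (j%:R + a + 1))).

End SpecialFunctions.

(* Main.v *)
(** For t and x on the sphere the Laplacian of e^(lambda t.x) is F(t.x) with
    F(u) = (lambda^2 (1 - u^2) - (p - 1) lambda u) e^(lambda u), so the statistic
    is n^-1 times the sum over i, j of K(X_i.X_j), where K(x.y) is the mean over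
    t of F(t.x) F(t.y).

    Means of (t.x)^i (t.y)^j are found by polarizing the mean of (t.z)^(2N), which
    by rotation invariance is a constant times |z|^(2N).  They show that averaging
    against a function of t.y commutes with the Gegenbauer operator
    D f = (1 - u^2) f'' - (p - 1) u f'.  As D has distinct eigenvalues
    -k (k + p - 2) on polynomials, the Gegenbauer polynomials diagonalize the
    averaging operators (Funk-Hecke).  Since F = D e^(lambda .), the expansion of
    K is Parseval's identity for F, completeness coming from the uniform
    approximation of F by D applied to Taylor polynomials.

    The weighted integral on [-1, 1] and the mean on the sphere both annihilate
    (1 - u^2) f' - (p - 1) u f, hence agree up to a constant.  Self-adjointness of
    D gives a two-step recurrence for the moments of u^n C_k, which sums to the
    power series of the Bessel function. *)

From HB Require Import structures.
Require Import Defs.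
From mathcomp Require Import all_boot all_order all_algebra.
From mathcomp Require Import all_classical all_reals all_analysis.
From mathcomp Require Import measurable_realfun.
From mathcomp Require Import ring lra.
Set Implicit Arguments.
Unset Strict Implicit.
Unset Printing Implicit Defensive.
Import Order.TTheory GRing.Theory Num.Theory.
Import numFieldNormedType.Exports.
Local Open Scope ring_scope.

(** * Gegenbauer polynomials normalized at 1 *)

(** [nu] is known only through its invariance under orthogonal maps, so no density of t.x is at
    hand. The functional [gegL], given on polynomials by its moments alone, is the meeting point:
    the mean over the sphere and the normalized weighted integral are each identified with it, and
    orthogonality, norms and Bessel coefficients are computed inside it by algebra. Functions that
    are not polynomials enter only as uniform limits of polynomials on [-1, 1].

    The factor [gamma_coef] reconciles two normalizations. Write C_k = w Z_k with Z_k(1) = 1, and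
    let h and mu be the normalized integrals of Z_k^2 and of e^(lambda u) Z_k. Then m_k = mu / (w h)
    and gamma_k = w h. With l = k (k + p - 2), the k-th term of the expansion of K is (l mu)^2 / h
    Z_k, which equals (l m_k)^2 gamma_k C_k. The sum starts at k = 1 because l = 0 for k = 0. *)

Section LinearExtension.
Context {R : nzRingType} {V : lmodType R} (m : nat -> V).

(** Scalar moments give a functional ([gegL]), polynomial moments an averaging operator
    ([zconvL]). *)
Definition linext (f : {poly R}) : V := \sum_(i < size f) f`_i *: m i.

Lemma linext_widen n (f : {poly R}) : (size f <= n)%N ->
  linext f = \sum_(i < n) f`_i *: m i.
Proof.
move=> sfn; rewrite /linext (big_ord_widen n (fun i => f`_i *: m i))// big_mkcond.
apply: eq_bigr => i _; case: ifPn => //; rewrite -leqNgt => h.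
by rewrite nth_default// scale0r.
Qed.

Lemma linext_is_linear : linear linext.
Proof.
move=> c f g; set n := maxn (size f) (size g).
rewrite (@linext_widen n (_ + _)) ?(@linext_widen n f) ?(@linext_widen n g) ?leq_maxl
  ?leq_maxr//.
  rewrite scaler_sumr -big_split; apply: eq_bigr => i _ /=.
  by rewrite coefD coefZ scalerDl scalerA.
rewrite (leq_trans (size_polyD _ _))// geq_max leq_maxr andbT.
by rewrite (leq_trans (size_scale_leq _ _))// leq_maxl.
Qed.

HB.instance Definition _ := GRing.isLinear.Build R {poly R} V _ linext linext_is_linear.

Lemma linextXn n : linext 'X^n = m n.
Proof.
rewrite (@linext_widen n.+1) ?size_polyXn// big_ord_recr /= coefXn eqxx scale1r.
rewrite big1 ?add0r// => i _; rewrite coefXn ltn_eqF ?scale0r//.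
Qed.

Lemma poly_lin_ind (P : {poly R} -> Prop) : (forall n, P 'X^n) ->
  (forall c f g, P f -> P g -> P (c *: f + g)) -> forall f, P f.
Proof.
move=> hX hlin f; rewrite -[f]coefK poly_def.
have P0 : P 0 by have := hlin (-1) _ _ (hX 0) (hX 0); rewrite scaleN1r addNr.
elim/big_ind: _ => // [g h Pg Ph|i _]; first by rewrite -[g]scale1r; exact: hlin.
by rewrite -[_ *: _]addr0; exact: hlin.
Qed.

End LinearExtension.

(** * The Gegenbauer operator and its moment functional *)

Section NormalizedGegenbauer.
Context {R : realFieldType} (a : R).
Hypothesis a_ge0 : 0 <= a.
Implicit Types (f g : {poly R}) (k : nat).

(* Normalizing by the value at 1 makes [a = 0] (Chebyshev) a regular case. *)
Fixpoint zgeg k : {poly R} :=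
  match k with
  | 0 => 1
  | 1 => 'X
  | (k''.+1 as k').+1 =>
      (k''.+1%:R + 2 * a)^-1 *:
        ((2 * (k''.+1%:R + a)) *: ('X * zgeg k') - k''.+1%:R *: zgeg k'')
  end.

(** With a = (p - 2) / 2, so that 2a + 1 = p - 1, this is the Laplace-Beltrami operator acting on
    functions of t.x. *)
Definition gegD f : {poly R} :=
  (1 - 'X^2) * f^`()^`() - ((2 * a + 1)%:P * 'X) * f^`().

Lemma zgegSS k : zgeg k.+2 = (k.+1%:R + 2 * a)^-1 *:
  ((2 * (k.+1%:R + a)) *: ('X * zgeg k.+1) - k.+1%:R *: zgeg k).
Proof. by []. Qed.

Let pos k : 0 < k.+1%:R + 2 * a.
Proof. by rewrite ltr_wpDr ?mulr_ge0 ?ler0n // ltr0n. Qed.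

Lemma zgeg_rec k : (k.+1%:R + 2 * a)%:P * zgeg k.+2 =
  (2 * (k.+1%:R + a))%:P * ('X * zgeg k.+1) - k.+1%:R%:P * zgeg k.
Proof.
by rewrite zgegSS mul_polyC scalerA divff ?scale1r ?gt_eqF// !mul_polyC.
Qed.

Lemma zgeg_eval1 k : (zgeg k).[1] = 1.
Proof.
suff: (zgeg k).[1] = 1 /\ (zgeg k.+1).[1] = 1 by case.
elim: k => [|k [h1 h2]]; first by rewrite /= hornerC hornerX.
split=> //; rewrite zgegSS !(hornerZ, hornerD, hornerN, hornerM, hornerX) h1 h2.
have /lt0r_neq0 := pos k => h; by field; rewrite nat1r.
Qed.

Let polyC_lreg (c : R) (f g : {poly R}) : c != 0 -> c%:P * f = c%:P * g -> f = g.
Proof. by move=> c0; apply: mulfI; rewrite polyC_eq0. Qed.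

(** The two identities need each other. The second at k + 1 follows from the recurrence and both at
    k; the first at k + 1 is the derivative of the recurrence, once [E] has eliminated the
    derivative of [zgeg k.+1]. *)
Lemma zgeg_deriv k :
  (k.+1%:R + 2 * a)%:P * (zgeg k.+2)^`() =
     k.+2%:R * ('X * (zgeg k.+1)^`() + (k.+1%:R + 2 * a)%:P * zgeg k.+1) /\
  (1 - 'X^2) * (zgeg k.+1)^`() = k.+1%:R * (zgeg k - 'X * zgeg k.+1).
Proof.
elim: k => [|k [IH1 IH2]].
  split; last by rewrite /= derivX; ring.
  have /(congr1 deriv) := zgeg_rec 0.
  rewrite [in LHS]derivM derivC mul0r add0r => ->.
  by rewrite /= derivB !derivM derivX -polyC1 !derivC; ring.
have H2 : (1 - 'X^2) * (zgeg k.+2)^`() = k.+2%:R * (zgeg k.+1 - 'X * zgeg k.+2).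
  apply: (@polyC_lreg (k.+1%:R + 2 * a)); first by rewrite gt_eqF.
  have h := zgeg_rec k.
  transitivity (k.+2%:R * ('X * ((1 - 'X^2) * (zgeg k.+1)^`())
      + (1 - 'X^2) * ((k.+1%:R + 2 * a)%:P * zgeg k.+1))).
    by rewrite mulrCA IH1; ring.
  transitivity (k.+2%:R * ((k.+1%:R + 2 * a)%:P * zgeg k.+1
      - 'X * ((k.+1%:R + 2 * a)%:P * zgeg k.+2))); last by ring.
  by rewrite h IH2; ring.
split; last exact: H2.
have /(congr1 deriv) := zgeg_rec k.+1.
rewrite derivB !derivM !derivC !derivX !mul0r !add0r mul1r => ->.
have h := zgeg_rec k.
have E : k.+2%:R * (zgeg k.+1)^`() =
  (k.+1%:R + 2 * a)%:P * ('X * (zgeg k.+2)^`() - k.+2%:R * zgeg k.+2).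
  transitivity ('X * (k.+2%:R * ('X * (zgeg k.+1)^`() + (k.+1%:R + 2 * a)%:P * zgeg
    k.+1)) - k.+2%:R * ((2 * (k.+1%:R + a))%:P * ('X * zgeg k.+1) - k.+1%:R%:P * zgeg
    k)); last first.
    by rewrite -IH1 -h; ring.
  transitivity (k.+2%:R * ((1 - 'X^2) * (zgeg k.+1)^`() + 'X^2 * (zgeg k.+1)^`()));
    first by ring.
  by rewrite IH2; ring.
rewrite polyC_natr E; ring.
Qed.

Lemma zgeg_deriv_pred k : k.+1%:R * (zgeg k)^`() =
  (k%:R + 2 * a)%:P * ('X * (zgeg k.+1)^`() - k.+1%:R * zgeg k.+1).
Proof.
case: k => [|k]; first by rewrite /= derivC derivX; ring.
have [IH1 IH2] := zgeg_deriv k; have h := zgeg_rec k.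
transitivity ('X * (k.+2%:R * ('X * (zgeg k.+1)^`() + (k.+1%:R + 2 * a)%:P * zgeg
  k.+1)) - k.+2%:R * ((2 * (k.+1%:R + a))%:P * ('X * zgeg k.+1) - k.+1%:R%:P * zgeg
  k)); last first.
  by rewrite -IH1 -h; ring.
transitivity (k.+2%:R * ((1 - 'X^2) * (zgeg k.+1)^`() + 'X^2 * (zgeg k.+1)^`()));
  first by ring.
by rewrite IH2; ring.
Qed.

(** Differentiate (1 - X^2) Z_k' = k (Z_(k-1) - X Z_k); [zgeg_deriv_pred] removes the derivative of
    Z_(k-1). *)
Lemma zgeg_ode k : gegD (zgeg k) = - (k%:R * (k%:R + 2 * a))%:P * zgeg k.
Proof.
case: k => [|k]; first by rewrite /gegD /= -polyC1 !derivC; ring.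
have /(congr1 deriv) := (zgeg_deriv k).2.
have h := zgeg_deriv_pred k.
rewrite [in RHS]mulr_natl derivMn derivB !derivM derivB derivXn derivX -polyC1 derivC
  polyC1.
move=> /(canRL (addKr _)) E; rewrite /gegD E -[X in _ + X - _]mulr_natl.
transitivity (- (- 'X *+ 2 * (zgeg k.+1)^`()) + (k.+1%:R * (zgeg k)^`()
   - k.+1%:R * (zgeg k.+1 + 'X * (zgeg k.+1)^`()))  - (2 * a + 1)%:P * 'X * (zgeg
     k.+1)^`()).
  by ring.
by rewrite h; ring.
Qed.

Lemma size_zgeg_le k : (size (zgeg k) <= k.+1)%N.
Proof.
suff: (size (zgeg k) <= k.+1)%N /\ (size (zgeg k.+1) <= k.+2)%N by case.
elim: k => [|k [h1 h2]]; first by rewrite /= size_poly1 size_polyX.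
split=> //; rewrite zgegSS; apply: leq_trans (size_scale_leq _ _) _.
apply: leq_trans (size_polyD _ _) _; rewrite size_polyN geq_max; apply/andP; split.
  apply: leq_trans (size_scale_leq _ _) _.
  by apply: leq_trans (size_polyMleq _ _) _; rewrite size_polyX.
by apply: leq_trans (size_scale_leq _ _) _; rewrite (leq_trans h1)// ltnW.
Qed.

Lemma coef_zgegSS k : (zgeg k.+2)`_k.+2 =
  2 * (k.+1%:R + a) / (k.+1%:R + 2 * a) * (zgeg k.+1)`_k.+1.
Proof.
rewrite zgegSS coefZ coefB !coefZ coefXM /= [X in _ - _ * X]nth_default ?size_zgeg_le//.
  by rewrite mulr0 subr0; ring.
by rewrite (leq_trans (size_zgeg_le k)).
Qed.

Lemma coef_zgeg_gt0 k : 0 < (zgeg k)`_k.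
Proof.
case: k => [|k]; first by rewrite /= coefC.
elim: k => [|k IH]; first by rewrite /= coefX.
rewrite coef_zgegSS mulr_gt0// divr_gt0// mulr_gt0//.
by rewrite ltr_wpDr// ltr0n.
Qed.

Lemma size_zgeg k : size (zgeg k) = k.+1.
Proof.
apply/eqP; rewrite eqn_leq size_zgeg_le ltnNge; apply/negP => h.
by have := coef_zgeg_gt0 k; rewrite nth_default// ltxx.
Qed.

(* Moments of the normalized weight (1 - u^2)^(a - 1/2) on [-1, 1]; with
   [a = (p - 2) / 2] they are also the moments of t.x on the sphere. *)
Fixpoint gegmom k : R :=
  match k with
  | 0 => 1
  | 1 => 0
  | k''.+2 => k''.+1%:R / (k''.+2%:R + 2 * a) * gegmom k''
  end.

Definition gegL : {poly R} -> R := linext (gegmom : nat -> R^o).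

Lemma gegL_is_scalar : scalar gegL.
Proof. exact: (@linext_is_linear R R^o gegmom). Qed.

HB.instance Definition _ := GRing.isLinear.Build R {poly R} R^o _ gegL gegL_is_scalar.

Lemma gegLZ c f : gegL (c *: f) = c * gegL f.
Proof. exact: linearZ. Qed.

Lemma gegLCM c f : gegL (c%:P * f) = c * gegL f.
Proof. by rewrite mul_polyC gegLZ. Qed.

Lemma gegLXn n : gegL 'X^n = gegmom n.
Proof. exact: (@linextXn R R^o gegmom). Qed.

(* The derivative of f (1 - u^2)^(a + 1/2) divided by the weight. *)
Definition gegjac f : {poly R} := (1 - 'X^2) * f^`() - (2 * a + 1)%:P * ('X * f).

(** On monomials this is exactly the two-step recurrence that defines [gegmom]. *)
Lemma gegL_jacobi f : gegL (gegjac f) = 0.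
Proof.
rewrite /gegjac; elim/(@poly_lin_ind R): f => [n|c f g hf hg]; last first.
  rewrite derivD derivZ.
  rewrite [X in gegL X](_ : _ = c *: ((1 - 'X^2) * f^`() - (2 * a + 1)%:P * ('X * f)) +
    ((1 - 'X^2) * g^`() - (2 * a + 1)%:P * ('X * g))).
    by rewrite linearP /= hf hg mulr0 addr0.
  by rewrite -!mul_polyC; ring.
rewrite raddfB /= gegLCM -exprS gegLXn derivXn.
case: n => [|n]; first by rewrite /= !mulr0 raddf0 subr0.
have -> : (1 - 'X^2) * ('X^n *+ n.+1) = n.+1%:R%:P * ('X^n - 'X^(n.+2)) :> {poly R}.
  by rewrite polyC_natr -mulr_natl !exprS; ring.
rewrite gegLCM raddfB /= !gegLXn /=.
have hn : n.+2%:R + 2 * a != 0 by rewrite gt_eqF.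
by field; rewrite -natrD.
Qed.

Lemma gegD_is_linear : linear gegD.
Proof.
by move=> c f g; rewrite /gegD !linearP /= -!mul_polyC; ring.
Qed.

HB.instance Definition _ :=
  GRing.isLinear.Build R {poly R} {poly R} _ gegD gegD_is_linear.

(** Green's formula: (D f) g - f (D g) is [gegjac] of f' g - f g'. *)
Lemma gegL_selfadj f g : gegL (gegD f * g) = gegL (f * gegD g).
Proof.
have h1 := gegL_jacobi (f^`() * g); have h2 := gegL_jacobi (f * g^`()).
rewrite /gegjac !derivM in h1 h2; apply/eqP; rewrite -subr_eq0 -raddfB /=.
rewrite -[X in X == _]subr0 -{1}h1 -[gegL _ - gegL _]addr0 -{1}h2 -!raddfB -raddfD /=.
by rewrite [X in gegL X](_ : _ = 0) ?raddf0// /gegD; ring.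
Qed.

Lemma gegD_Xn n : gegD 'X^n =
  (n%:R * n.-1%:R : R) *: 'X^(n.-2) - (n%:R * (n%:R + 2 * a)) *: 'X^n.
Proof.
rewrite -!mul_polyC /gegD !derivXn derivMn derivXn; case: n => [|[|n]] /=.
- by rewrite !mulr0n; ring.
- by rewrite !mulr0n; ring.
by rewrite !exprS; ring.
Qed.

(** Self-adjointness applied to X^(n+2) and Z_k; the difference of the eigenvalues (n + 2) (n + 2 +
    2a) and k (k + 2a) factors. Orthogonality, parity and the Bessel series all come from this
    relation. *)
Lemma gegL_Xn_zgeg_rec n k :
  (n.+2%:R - k%:R) * (n.+2%:R + k%:R + 2 * a) * gegL ('X^(n.+2) * zgeg k) =
  n.+2%:R * n.+1%:R * gegL ('X^n * zgeg k).
Proof.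
have h := gegL_selfadj 'X^(n.+2) (zgeg k).
rewrite gegD_Xn zgeg_ode mulrBl -!scalerAl raddfB /= !gegLZ in h.
rewrite [in RHS]mulNr mulrN raddfN /= [in RHS]mulrCA gegLCM in h.
by move/eqP: h; rewrite subr_eq => /eqP ->; ring.
Qed.

(** The recurrence steps by two, so n = 0 and n = 1 are the bases: 1 and X are eigenvectors of D,
    with eigenvalues different from that of Z_k. *)
Lemma gegL_Xn_zgeg0 n k : (n < k)%N -> gegL ('X^n * zgeg k) = 0.
Proof.
elim/ltn_ind: n k => -[|[|n]] IH k nk.
- have := gegL_selfadj 1 (zgeg k).
  rewrite zgeg_ode mul1r mulNr raddfN /= gegLCM expr0 mul1r.
  rewrite /gegD -polyC1 !(derivC,deriv0) !mulr0 subr0 mul0r raddf0 => /esym/eqP.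
  rewrite oppr_eq0 !mulf_eq0 => /orP[/orP[]|/eqP//].
    by rewrite pnatr_eq0 gtn_eqF.
  by case: k nk => // k _; rewrite gt_eqF.
- have := gegL_selfadj 'X (zgeg k).
  rewrite zgeg_ode mulNr mulrN mulrCA raddfN /= gegLCM expr1.
  rewrite /gegD derivX -polyC1 derivC mulr0 sub0r mulr1 mulNr raddfN /= -mulrA gegLCM
    => /eqP.
  rewrite eqr_opp -subr_eq0 -mulrBl mulf_eq0 => /orP[|/eqP//].
  case: k nk => [|[|k]]// _; rewrite (_ : _ - _ = - (k.+1%:R * (k.+3%:R + 2 * a)));
    last by ring.
  by rewrite oppr_eq0 mulf_eq0 !gt_eqF.
have nk' : (n < k)%N := ltnW (ltnW nk).
have := gegL_Xn_zgeg_rec n k; rewrite (IH n)// mulr0.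
move=> /eqP; rewrite !mulf_eq0 => /orP[/orP[]|/eqP//].
  by rewrite subr_eq0 eqr_nat ltn_eqF.
by rewrite -natrD addSn gt_eqF.
Qed.

(** Parity, read off the recurrence: it ties this moment to one of degree too low to survive. *)
Lemma gegL_XSn_zgeg0 k : gegL ('X^(k.+1) * zgeg k) = 0.
Proof.
case: k => [|k]; first by rewrite mulr1 gegLXn.
have := gegL_Xn_zgeg_rec k k.+1; rewrite (@gegL_Xn_zgeg0 k)// mulr0 => /eqP.
rewrite !mulf_eq0 => /orP[/orP[]|/eqP//].
  by rewrite subr_eq0 eqr_nat gtn_eqF.
by rewrite -natrD addSn gt_eqF.
Qed.

Lemma gegL_Xn_zgeg_odd k j : gegL ('X^(k + j.*2.+1) * zgeg k) = 0.
Proof.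
elim: j => [|j IH]; first by rewrite addn1 gegL_XSn_zgeg0.
have := gegL_Xn_zgeg_rec (k + j.*2.+1) k.
rewrite IH mulr0 doubleS !addnS => /eqP.
rewrite !mulf_eq0 => /orP[/orP[]|/eqP//].
  by rewrite subr_eq0 eqr_nat gtn_eqF// ltnS -!addnS leq_addr.
by rewrite -natrD addSn gt_eqF.
Qed.

(** Pair X^k with the three-term recurrence: Z_(k+2) drops out by orthogonality. *)
Lemma gegL_diagS k : gegL ('X^(k.+1) * zgeg k.+1) =
  k.+1%:R / (2 * (k.+1%:R + a)) * gegL ('X^k * zgeg k).
Proof.
have /(congr1 (fun f => gegL ('X^k * f))) := zgeg_rec k.
rewrite [in LHS]mulrCA gegLCM [in LHS]gegL_Xn_zgeg0// mulr0 mulrBr raddfB /=.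
rewrite [X in gegL X - _]mulrCA [X in _ - gegL X]mulrCA !gegLCM mulrA -exprSr.
move=> /esym/eqP; rewrite subr_eq0 => /eqP h.
rewrite mulrAC -h mulrAC divff ?mul1r// gt_eqF// mulr_gt0// ltr_wpDr// ltr0n.
Qed.

Lemma gegL_diag_gt0 k : 0 < gegL ('X^k * zgeg k).
Proof.
elim: k => [|k IH]; first by rewrite mulr1 gegLXn.
rewrite gegL_diagS mulr_gt0// divr_gt0// mulr_gt0// ltr_wpDr// ltr0n.
Qed.

Lemma gegL_zgeg k f : (size f <= k.+1)%N ->
  gegL (f * zgeg k) = f`_k * gegL ('X^k * zgeg k).
Proof.
move=> sf; rewrite -[f in LHS](@take_poly_id _ k.+1)// /take_poly poly_def
  big_ord_recr /=.
rewrite mulrDl raddfD /= -scalerAl gegLZ mulr_suml raddf_sum /= big1 ?add0r// => i _.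
by rewrite -scalerAl gegLZ gegL_Xn_zgeg0// mulr0.
Qed.

Definition zgeg_sqnorm k := gegL (zgeg k * zgeg k).

Lemma zgeg_sqnormE k : zgeg_sqnorm k = (zgeg k)`_k * gegL ('X^k * zgeg k).
Proof. by rewrite /zgeg_sqnorm gegL_zgeg// size_zgeg. Qed.

Lemma zgeg_sqnorm_gt0 k : 0 < zgeg_sqnorm k.
Proof. by rewrite zgeg_sqnormE mulr_gt0// ?coef_zgeg_gt0 ?gegL_diag_gt0. Qed.

Lemma zgeg_orth k l : k != l -> gegL (zgeg k * zgeg l) = 0.
Proof.
wlog kl : k l / (k < l)%N => [H|_].
  rewrite neq_ltn => /orP[kl|lk]; first by rewrite H// ltn_eqF.
  by rewrite mulrC H// ltn_eqF.
by rewrite gegL_zgeg ?nth_default ?mul0r// size_zgeg// ltnW.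
Qed.
End NormalizedGegenbauer.

(** * Zonal convolution of polynomials *)

Section ZonalConvolution.
Context {R : realFieldType} (a : R).
Hypothesis a_ge0 : 0 <= a.
Implicit Types (f g : {poly R}) (N i j : nat) (P Q : {poly {poly R}}).

(* 1 + 2 u s + s^2 = |x + s y|^2 for unit vectors with x.y = u; the outer
   variable is s. *)
Definition polar : {poly {poly R}} := 1 + ('X *+ 2)%:P * 'X + 'X^2.

Let du P := map_poly (@deriv R) P.

Let duM P Q : du (P * Q) = du P * Q + P * du Q.
Proof.
apply/polyP => n; rewrite coefD !coef_map /= !coefM raddf_sum -big_split /=.
by apply: eq_bigr => i _; rewrite derivM !coef_map.
Qed.

Let duX : du 'X = 0.
Proof. by apply/polyP => n; rewrite coef_map /= coefX -polyC_natr derivC coef0. Qed.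

Let duC f : du f%:P = (f^`())%:P.
Proof. by rewrite /du map_polyC. Qed.

Let du_nat n : du (n%:R) = 0.
Proof. by rewrite -polyC_natr duC -polyC_natr derivC polyC0. Qed.

Let duD P Q : du (P + Q) = du P + du Q.
Proof. exact: raddfD. Qed.

Let du_polar : du polar = 2 * 'X.
Proof.
rewrite /polar expr2 2!duD !duM duX duC (du_nat 1) derivMn derivX -mulr_natl mulr1
  polyC_natr.
by ring.
Qed.

Let du_exp N : du (polar ^+ N.+1) = N.+1%:R * polar ^+ N * (2 * 'X).
Proof.
elim: N => [|N IH]; first by rewrite expr1 expr0 du_polar; ring.
by rewrite exprS duM IH du_polar !exprS; ring.
Qed.

Let du2_exp N : du (du (polar ^+ N.+2)) =
  N.+2%:R * N.+1%:R * polar ^+ N * (2 * 'X) ^+ 2.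
Proof.
rewrite du_exp !duM du_exp duX.
by rewrite !du_nat; ring.
Qed.

(** The Euler operator s d/ds multiplies the coefficient of s^j by j, so a differential identity in
    s becomes a relation between coefficients. *)
Let ds P := 'X * P^`().

Let deriv_polar : polar^`() = ('X *+ 2)%:P + 2 * 'X.
Proof.
rewrite /polar 2!derivD derivXn derivM derivC derivX -polyC1 derivC.
by ring.
Qed.

Let deriv_exp_polar N : (polar ^+ N.+1)^`() =
  N.+1%:R * polar ^+ N * (('X *+ 2)%:P + 2 * 'X).
Proof. by rewrite deriv_exp deriv_polar mulrAC -mulr_natl /=; ring. Qed.

Let gegDu P := (1 - 'X^2)%:P * du (du P) - ((2 * a + 1)%:P * 'X)%:P * du P.

(** D in the variable u is traded for s d/ds, which is possible because 1 - u^2 = [polar] - (u +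
    s)^2. *)
Let gegDu_exp N :
  gegDu (polar ^+ N) = (2 * N%:R * (2 * N%:R + 2 * a))%:P%:P * polar ^+ N.-1
   - ((2 * N%:R) * (2 * N%:R + 2 * a))%:P%:P * polar ^+ N
   + (4 * N%:R + 2 * a)%:P%:P * ds (polar ^+ N) - ds (ds (polar ^+ N)).
Proof.
have dsM P Q : ds (P * Q) = ds P * Q + P * ds Q by rewrite /ds derivM; ring.
have derivnat n : (n%:R : {poly {poly R}})^`() = 0 by rewrite -polyC_natr derivC.
rewrite /gegDu; case: N => [|[|N]].
- rewrite expr0 /ds (derivnat 1) !mulr0 derivC (du_nat 1) (du_nat 0); ring.
- have e1 := deriv_exp_polar 0; have e2 := du_exp 0.
  rewrite expr1 expr0 in e1 e2 *.
  rewrite /ds e1 e2 !(derivM, derivD, derivC, derivX, derivnat, duM, du_nat,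
    duX) /polar /=.
  by ring.
rewrite /ds deriv_exp_polar du2_exp du_exp !(derivM, deriv_exp_polar, derivD, derivC,
  derivX, derivnat).
by rewrite /= !exprS; set V := polar ^+ N; rewrite /polar; ring.
Qed.

Let coef_ds P j : (ds P)`_j = j%:R * P`_j.
Proof.
rewrite /ds coefXM coef_deriv; case: j => [|j]; first by rewrite mul0r.
by rewrite /= mulr_natl.
Qed.

Lemma gegD_coef_polar N i j : (i + j = N.*2)%N ->
  gegD a (polar ^+ N)`_j = (2 * N%:R * (2 * N%:R + 2 * a)) *: (polar ^+ N.-1)`_j
    - (i%:R * (i%:R + 2 * a)) *: (polar ^+ N)`_j.
Proof.
move=> ijN; have := congr1 (fun P => P`_j) (gegDu_exp N).
rewrite /gegDu !(coefB, coefD, coefCM, coef_ds) !coef_map /= -/(gegD _ _) => ->.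
rewrite -!mul_polyC.
have -> : i%:R = 2 * N%:R - j%:R :> R by rewrite -mul2n in ijN;
  rewrite -natrM -ijN natrD addrK.
by rewrite -!(polyC_natr _ j); ring.
Qed.

Lemma size_exp_polar N : (size (polar ^+ N) <= N.*2.+1)%N.
Proof.
apply: leq_trans (size_poly_exp_leq _ _) _; rewrite ltnS -mul2n leq_mul2r; apply/orP;
  right.
suff : (size polar <= 3)%N by case: (size polar).
rewrite /polar (leq_trans (size_polyD _ _))// size_polyXn geq_max andbT.
rewrite (leq_trans (size_polyD _ _))// geq_max size_poly1 /=.
rewrite (leq_trans (size_polyMleq _ _))// size_polyX addn2 /= size_polyC.
by case: eqP.
Qed.

(* As a polynomial in x.y, the mean of (t.x)^i (t.y)^j. *)
Definition zconv i j : {poly R} :=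
  if odd (i + j) then 0
  else (gegmom a (i + j) / 'C(i + j, j)%:R) *: (polar ^+ (i + j)./2)`_j.

Lemma bin_add2l i j : ((i + j).+2 * (i + j).+1 * 'C(i + j, j) =
  i.+2 * i.+1 * 'C((i + j).+2, j))%N.
Proof.
have h1 := bin_fact (leq_addl i j); have h2 := bin_fact (leq_addl i.+2 j).
rewrite addnK in h1; rewrite addnK !addSn !factS in h2.
have j0 : (0 < j`! * i`!)%N by rewrite muln_gt0 !fact_gt0.
apply/eqP; rewrite -(eqn_pmul2r j0); apply/eqP.
by rewrite -[LHS]mulnA h1 -mulnA -h2; ring.
Qed.

(** The same shape as [gegD_Xn], with [zconv] in place of the monomials: this is what makes
    averaging commute with D. *)
Lemma gegD_zconv i j : gegD a (zconv i j) =
  (i%:R * i.-1%:R) *: zconv i.-2 j - (i%:R * (i%:R + 2 * a)) *: zconv i j.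
Proof.
have [oij|eij] := boolP (odd (i + j)).
  rewrite {1 3}/zconv oij raddf0 scaler0 subr0.
  case: i oij => [|[|i]]; rewrite ?mul0r ?mulr0 ?scale0r// => oij.
  by rewrite !addSn /= negbK in oij; rewrite /zconv /= oij scaler0.
have eN : (i + j)%N = ((i + j)./2).*2 by rewrite even_halfK.
rewrite {1 3}/zconv (negPf eij) linearZ /= (gegD_coef_polar eN) scalerBr !scalerA.
congr (_ - _); last by rewrite mulrC.
case: i eij eN => [|[|i]] eij eN.
(* For i = 0 and i = 1 the index j exceeds the degree in s of the lower power of [polar], so only
   the eigenvalue term remains. If m = 0, the scalar in front is 0. *)
- rewrite !mul0r scale0r; move: eN; rewrite add0n; set m := j./2 => jm.
  have [m0|m0] := posnP m; first by rewrite m0 !mulr0 mul0r mulr0 scale0r.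
  rewrite nth_default ?scaler0// (leq_trans (size_exp_polar _))// jm.
  by case: m m0 {jm}.
- rewrite mulr0 scale0r; move: eN; rewrite add1n; set m := (j.+1)./2 => jm.
  rewrite nth_default ?scaler0// (leq_trans (size_exp_polar _))//.
  by case: m jm => [|m]//=; rewrite doubleS => -[->].
rewrite /zconv !addSn /= negbK in eij *.
rewrite (negPf eij) scalerA; congr (_ *: _).
have h := congr1 (fun n => n%:R : R) (bin_add2l i j); rewrite !natrM in h.
have -> : 2 * ((i+j)./2.+1)%:R =
  (i + j).+2%:R :> R by rewrite -natrM mul2n doubleS even_halfK.
have hp : (i + j).+2%:R + 2 * a != 0 by rewrite gt_eqF// ltr_wpDr// ?mulr_ge0.
have c1 : 'C((i + j).+2, j)%:R != 0 :> R by rewrite pnatr_eq0 -lt0n bin_gt0 -!addSn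
  leq_addl.
have c2 : 'C(i + j, j)%:R != 0 :> R by rewrite pnatr_eq0 -lt0n bin_gt0 leq_addl.
rewrite /=; move: h hp c1 c2;
  move: ((i + j).+2%:R) ((i + j).+1%:R) ('C(_, _)%:R) ('C(_, _)%:R) (i.+2%:R) (i.+1%:R).
move=> A B c1 c2 I2 I1 h hp c1n c2n.
transitivity (gegmom a (i + j) * (A * B * c2) / (c1 * c2)); first by field;
  rewrite ?c1n ?c2n ?hp.
by rewrite h; field; rewrite ?c1n ?c2n ?hp.
Qed.

(** The mean of f(t.x) (t.y)^j, as a polynomial in x.y. *)
Definition zconvL j f : {poly R} := linext (zconv^~ j) f.

Lemma zconvL_is_linear j : linear (zconvL j).
Proof. exact: linext_is_linear. Qed.

HB.instance Definition _ j :=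
  GRing.isLinear.Build R {poly R} {poly R} _ (zconvL j) (zconvL_is_linear j).

Lemma zconvLXn j n : zconvL j 'X^n = zconv n j.
Proof. exact: linextXn. Qed.

Lemma gegD_zconvL j f : gegD a (zconvL j f) = zconvL j (gegD a f).
Proof.
elim/(@poly_lin_ind R): f => [n|c f g hf hg]; last by rewrite !linearP /= hf hg.
by rewrite zconvLXn gegD_zconv gegD_Xn linearB !linearZ /= !zconvLXn.
Qed.

Lemma coef_gegD f n :
  (gegD a f)`_n = n.+2%:R * n.+1%:R * f`_n.+2 - n%:R * (n%:R + 2 * a) * f`_n.
Proof.
rewrite /gegD mulrBl mul1r !coefB coefXnM -mulrA coefCM coefXM !coef_deriv.
by case: n => [|[|n]] /=; rewrite ?subn2 /=; ring.
Qed.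

(* Comparing leading coefficients, an eigenvector for the k-th eigenvalue has
   degree k, and two of them have a combination of smaller degree. *)
Lemma gegD_eigen k f : gegD a f = - (k%:R * (k%:R + 2 * a))%:P * f ->
  f = f.[1] *: zgeg a k.
Proof.
have eigsize (g : {poly R}) : gegD a g = - (k%:R * (k%:R + 2 * a))%:P * g ->
    g != 0 -> size g = k.+1.
  move=> hg g0; have : (0 < size g)%N by rewrite size_poly_gt0.
  case Eg : (size g) => [//|n] _.
  have gn : g`_n != 0 by move: g0; rewrite -lead_coef_eq0 /lead_coef Eg.
  have := congr1 (fun h : {poly R} => h`_n) hg.
  rewrite mulNr coefN coefCM coef_gegD [g`_n.+2]nth_default ?Eg// mulr0 sub0r.
  move/oppr_inj/(mulIf gn)/eqP; rewrite -subr_eq0.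
  rewrite (_ : _ - _ = (n%:R - k%:R) * (n%:R + k%:R + 2 * a)); last by ring.
  rewrite mulf_eq0 subr_eq0 eqr_nat => /orP[/eqP->//|].
  rewrite -natrD paddr_eq0 ?mulr_ge0 ?ler0n// pnatr_eq0 addn_eq0.
  by move=> /andP[/andP[/eqP-> /eqP->]].
move=> hf; set c := f`_k / (zgeg a k)`_k.
have zk : (zgeg a k)`_k != 0 by rewrite gt_eqF// coef_zgeg_gt0.
have f0 : f - c *: zgeg a k = 0.
  apply/eqP/negPn/negP => g0; have sg := eigsize _ _ g0.
  have : (f - c *: zgeg a k)`_k = 0 by rewrite coefB coefZ /c divfK ?subrr.
  move/eqP; apply/negP.
  have := sg; rewrite linearB linearZ /= hf zgeg_ode// mulrBr -scalerAr =>
    /(_ erefl) sg'.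
  by move: g0; rewrite -lead_coef_eq0 /lead_coef sg'.
move/eqP: f0; rewrite subr_eq0 => /eqP ->.
by rewrite hornerZ zgeg_eval1// mulr1.
Qed.

(** An operator commuting with D preserves the eigenspaces of D, and these are lines. This is the
    algebraic core of the Funk-Hecke formula. *)
Lemma zconvL_zgeg j k : zconvL j (zgeg a k) = (zconvL j (zgeg a k)).[1] *: zgeg a k.
Proof.
apply: gegD_eigen; rewrite gegD_zconvL zgeg_ode// -polyCN mul_polyC linearZ /=.
by rewrite -mul_polyC.
Qed.

End ZonalConvolution.

Local Open Scope classical_set_scope.
Local Open Scope ring_scope.

(** * Means over the sphere *)

Lemma continuous_mx (T : topologicalType) (R : realType) m n (g : T -> 'M[R]_(m, n)) :
  (forall i j, continuous (fun t => g t i j)) -> continuous g.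
Proof.
move=> cg t A [P hP PA]; apply: (filterS PA).
by do 2 (apply: filter_forall => ?); apply: cg; exact: hP.
Qed.

(** * Euclidean geometry of the sphere *)

Section Dot.
Context {R : realType} {p : nat}.
Implicit Types x y t : 'rV[R]_p.

Lemma dotE x y : dot x y = (x *m y^T) ord0 ord0.
Proof. by rewrite mxE; apply: eq_bigr => i _; rewrite mxE. Qed.

Lemma dotC x y : dot x y = dot y x.
Proof. by apply: eq_bigr => i _; rewrite mulrC. Qed.

Lemma dotDl x y t : dot (x + y) t = dot x t + dot y t.
Proof. by rewrite !dotE mulmxDl mxE. Qed.

Lemma dotZl c x t : dot (c *: x) t = c * dot x t.
Proof. by rewrite !dotE -scalemxAl mxE. Qed.

Lemma dotNl x t : dot (- x) t = - dot x t.
Proof. by rewrite -scaleN1r dotZl mulN1r. Qed.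

Lemma dotDr t x y : dot t (x + y) = dot t x + dot t y.
Proof. by rewrite !(dotC t) dotDl. Qed.

Lemma dotZr c t x : dot t (c *: x) = c * dot t x.
Proof. by rewrite !(dotC t) dotZl. Qed.

Lemma dotNr t x : dot t (- x) = - dot t x.
Proof. by rewrite !(dotC t) dotNl. Qed.

Lemma dot_ge0 x : 0 <= dot x x.
Proof. by apply: sumr_ge0 => i _; rewrite -expr2 sqr_ge0. Qed.

Lemma dot_eq0 x : (dot x x == 0) = (x == 0).
Proof.
apply/eqP/eqP => [|->]; last by rewrite -[0](scale0r 0) dotZl mul0r.
move=> /eqP; rewrite psumr_eq0 => [/allP h|i _]; last by rewrite -expr2 sqr_ge0.
apply/rowP => i; rewrite mxE; have := h i (mem_index_enum _).
by rewrite /= mulf_eq0 orbb => /eqP.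
Qed.

Lemma sphereE x : sphere R p x <-> dot x x = 1.
Proof.
rewrite /sphere /enorm /=; split => [h|->]; last by rewrite sqrtr1.
by rewrite -[LHS]sqr_sqrtr ?dot_ge0// h expr1n.
Qed.

Lemma dot_sphere_le1 x y : sphere R p x -> sphere R p y -> -1 <= dot x y <= 1.
Proof.
move=> /sphereE hx /sphereE hy.
have := dot_ge0 (x + y); have := dot_ge0 (x - y).
rewrite !(dotDl, dotDr, dotNl, dotNr) hx hy (dotC y x).
by move=> h1 h2; apply/andP; split; lra.
Qed.

Lemma dot_delta x i : dot x (delta_mx ord0 i) = x ord0 i.
Proof.
rewrite /dot (bigD1 i)//= mxE !eqxx mulr1 big1 ?addr0// => j ji.
by rewrite mxE (negPf ji) andbF mulr0.
Qed.

Lemma dot_continuous x : continuous (dot x).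
Proof.
move=> t; apply: (@continuous_big _ _ +%R) => [|i _].
  exact: add_continuous.
by move=> s; apply: continuousM; [exact: cst_continuous|exact: coord_continuous].
Qed.

Lemma dot_self_continuous : continuous (fun t : 'rV[R]_p => dot t t).
Proof.
move=> t; apply: (@continuous_big _ _ +%R) => [|i _].
  exact: add_continuous.
by move=> s; apply: continuousM; exact: coord_continuous.
Qed.

Lemma sphere_closed : closed (sphere R p).
Proof.
rewrite (_ : sphere R p = (fun t : 'rV[R]_p => dot t t) @^-1` [set 1]).
  by apply: preimage_closed; [move=> t _;
    exact: dot_self_continuous|apply: compact_closed;
    [exact: norm_hausdorff|exact: compact_set1]].
by apply/seteqP; split => t /sphereE.
Qed.

Lemma sphere_compact : compact (sphere R p).
Proof.
apply: bounded_closed_compact; last exact: sphere_closed.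
exists 1; split => // M M1 t /sphereE ht /=.
rewrite (le_trans _ (ltW M1))// [leLHS]/Num.Def.normr /= mx_normrE.
apply: bigmax_le => // -[i j] _ /=; rewrite ord1.
rewrite -[leRHS]sqrtr1 -sqrtr_sqr ler_wsqrtr// -ht /dot (bigD1 j)//= expr2 lerDl.
by apply: sumr_ge0 => k _; rewrite -expr2 sqr_ge0.
Qed.

(** For distinct x and y, the Householder reflection along v = x - y exchanges them. *)
Lemma orthogonal_transitive x y : sphere R p x -> sphere R p y ->
  exists2 Q : 'M[R]_p, Q *m Q^T = 1%:M & x *m Q = y.
Proof.
move=> /sphereE hx /sphereE hy.
have [->|xy] := eqVneq x y.
  by exists 1%:M; rewrite ?trmx1 mulmx1.
set v := x - y; set c := dot v v.
have c0 : c != 0 by rewrite dot_eq0 subr_eq0.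
have vv : v *m v^T = c%:M by apply/matrixP => i j; rewrite !ord1 -dotE mxE eqxx.
have xv : x *m v^T = (c / 2)%:M.
  apply/matrixP => i j; rewrite !ord1 -dotE mxE eqxx mulr1n /c /v.
  by rewrite !(dotDl, dotDr, dotNl, dotNr) hx hy (dotC y x); field.
set B := (2 / c) *: (v^T *m v).
have QT : (1%:M - B)^T = 1%:M - B.
  by rewrite linearB linearZ /= trmx1 trmx_mul trmxK.
have BB : B *m B = B + B.
  rewrite /B -scalemxAl -scalemxAr -mulmxA (mulmxA v) vv mul_scalar_mx -scalemxAr
    !scalerA.
  by rewrite -scalerDl; congr (_ *: _); field.
exists (1%:M - B); first by rewrite QT mulmxBl mul1mx mulmxBr mulmx1 BB opprB addrK
  subrK.
rewrite mulmxBr mulmx1 /B -scalemxAr mulmxA xv mul_scalar_mx scalerA.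
have -> : 2 / c * (c / 2) = 1 by field.
by rewrite scale1r /v opprB addrC subrK.
Qed.

Lemma dot_mulmx x t (Q : 'M[R]_p) : dot x (t *m Q) = dot (x *m Q^T) t.
Proof. by rewrite !dotE trmx_mul mulmxA. Qed.

End Dot.

(** * Integration over the sphere *)

Section SphereMean.
Context {R : realType} {p : nat}.
Variable nu : probability (borelRV R p) R.
Hypothesis hnu : uniform_on_sphere nu.
Implicit Types (f g : 'rV[R]_p -> R) (x y t : 'rV[R]_p).

Local Notation S := (sphere R p : set (borelRV R p)).

Lemma open_borelRV (A : set 'rV[R]_p) : open A -> measurable (A : set (borelRV R p)).
Proof. by move=> oA; exact: sub_sigma_algebra. Qed.

Lemma measurable_sphere : measurable S.
Proof.
rewrite -[S]setCK; apply: measurableC; apply: open_borelRV.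
by apply: closed_openC; exact: sphere_closed.
Qed.

Lemma continuous_measurable_rV f : continuous f ->
  measurable_fun setT (f : borelRV R p -> R).
Proof.
move=> /continuousP cf; apply: (measurability _ (RGenOpens.measurableE R)).
move=> _ [_ [a [b ->] <-]]; rewrite setTI; apply: open_borelRV.
exact/cf/interval_open.
Qed.

Lemma continuous_integrable f : continuous f -> nu.-integrable S (EFin \o f).
Proof.
move=> cf; apply: measurable_bounded_integrable; first exact: measurable_sphere.
- exact: le_lt_trans (probability_le1 nu measurable_sphere) (ltry 1).
- by apply: measurable_funTS; exact: continuous_measurable_rV.
have /compact_bounded : compact (f @` sphere R p).
  by apply: continuous_compact; [exact: continuous_subspaceT|exact: sphere_compact].
move=> [M [Mr hM]]; exists M; split => // N MN t St /=.
by apply: hM MN _ _; exists t.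
Qed.

Definition smean f : R := \int[nu]_(t in S) f t.

Lemma smean_cst c : smean (fun=> c) = c.
Proof.
rewrite /smean Rintegral_cst; last exact: measurable_sphere.
by rewrite [X in fine X](_ : _ = 1%E) ?mulr1//; exact: hnu.1.
Qed.

Lemma eq_smean f g : (forall t, sphere R p t -> f t = g t) -> smean f = smean g.
Proof. by move=> fg; apply: eq_Rintegral => t; rewrite inE => /fg. Qed.

Lemma smeanD f g : continuous f -> continuous g ->
  smean (fun t => f t + g t) = smean f + smean g.
Proof.
by move=> cf cg; apply: RintegralD;
  [exact: measurable_sphere|exact: continuous_integrable..].
Qed.

Lemma smeanZ c f : continuous f -> smean (fun t => c * f t) = c * smean f.
Proof.
by move=> cf; apply: RintegralZl;
  [exact: measurable_sphere|exact: continuous_integrable].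
Qed.

Lemma smean_sum (I : Type) (r : seq I) (F : I -> 'rV[R]_p -> R) :
  (forall i, continuous (F i)) ->
  smean (fun t => \sum_(i <- r) F i t) = \sum_(i <- r) smean (F i).
Proof.
move=> cF; elim: r => [|i r IH].
  by rewrite big_nil -[RHS](smean_cst 0); apply: eq_smean => t _; rewrite big_nil.
rewrite big_cons -IH -smeanD//; first by apply: eq_smean => t _; rewrite big_cons.
move=> t; apply: (@continuous_big _ _ +%R) => //; exact: add_continuous.
Qed.

Lemma smean_le f g : continuous f -> continuous g ->
  (forall t, sphere R p t -> f t <= g t) -> smean f <= smean g.
Proof.
by move=> cf cg fg; apply: le_Rintegral => //;
  [exact: measurable_sphere|exact: continuous_integrable..].
Qed.

(** Invariance is assumed for sets; it says that the pushforward of [nu] under t -> t Q is [nu], and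
    change of variables does the rest. *)
Lemma smean_orthogonal (Q : 'M[R]_p) f : Q *m Q^T = 1%:M -> continuous f ->
  smean (fun t => f (t *m Q)) = smean f.
Proof.
move=> QQ cf.
have cQ : continuous (fun t : 'rV[R]_p => t *m Q).
  apply: continuous_mx => i j; rewrite (_ : (fun _ => _) = dot (row j Q^T)).
    exact: dot_continuous.
  apply/funext => t; rewrite dotC dotE mxE mxE ord1; apply: eq_bigr => k _.
  by rewrite !mxE.
have mQ : measurable_fun setT ((fun t => t *m Q) : borelRV R p -> borelRV R p).
  apply: (@measurability _ _ _ (borelRV R p) setT _ (@open 'rV[R]_p)) => //.
  move=> _ [A oA <-]; rewrite setTI; apply: open_borelRV.
  by move/continuousP : cQ; exact.
rewrite /smean /Rintegral; congr fine.
have SQ : (fun t : borelRV R p => t *m Q : borelRV R p) @^-1` S = S.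
  by apply/seteqP; split => t /sphereE h; apply/sphereE; move: h;
    rewrite /= dot_mulmx -mulmxA QQ mulmx1.
rewrite -{1}SQ -[LHS](@integral_pushforward _ _ _ _ _ _ mQ nu S (EFin \o f)).
- apply: eq_measure_integral => A mA _; exact: hnu.2.
- by apply/measurable_EFinP; exact: continuous_measurable_rV.
- rewrite SQ; apply: (@continuous_integrable (f \o (fun t => t *m Q))).
  by move=> t; apply: continuous_comp; [exact: cQ|exact: cf].
- exact: measurable_sphere.
Qed.

End SphereMean.

Lemma eq_horner_poly (R : realFieldType) (P Q : {poly R}) :
  (forall s, P.[s] = Q.[s]) -> P = Q.
Proof.
move=> PQ; apply/eqP; rewrite -subr_eq0; apply/negPn/negP => D0.
have /(max_poly_roots D0) : all (root (P - Q)) [seq i%:R | i <- iota 0 (size (P - Q))].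
  by apply/allP => x _; rewrite rootE hornerD hornerN PQ subrr.
rewrite map_inj_uniq ?iota_uniq; last exact: mulrIn (oner_neq0 _).
by move=> /(_ isT); rewrite size_map size_iota ltnn.
Qed.

(** The coefficient of s^2 feeds [zonal_momentSS]; the two lower ones carry its induction. *)
Lemma coef_exp_polar012 (R : realFieldType) N :
  [/\ (polar ^+ N : {poly {poly R}})`_0 = 1,
      (polar ^+ N : {poly {poly R}})`_1 = (2 * N%:R)%:P * 'X &
      (polar ^+ N : {poly {poly R}})`_2 = N%:R%:P + (2 * N%:R * (N%:R - 1))%:P * 'X^2].
Proof.
elim: N => [|N [h0 h1 h2]].
  by rewrite expr0 !coefC /= !(mulr0, mul0r, addr0).
rewrite exprS {1 3 5}/polar !mulrDl !mul1r -!mulrA.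
split; rewrite !coefD coefCM !coefXM /= ?h0 ?h1 ?h2.
- by ring.
- by ring.
- by ring.
Qed.

(** * Moments of zonal functions and the Funk-Hecke formula *)

Section ZonalMoments.
Context {R : realType} {p : nat}.
Hypothesis p_ge2 : (2 <= p)%N.
Variable nu : probability (borelRV R p) R.
Hypothesis hnu : uniform_on_sphere nu.
Implicit Types (x y t : 'rV[R]_p).
Let a : R := (p%:R - 2) / 2.

Lemma gegindex_ge0 : 0 <= a.
Proof. by rewrite divr_ge0// subr_ge0 (ler_nat R 2). Qed.

Local Notation smean := (smean nu).

Lemma zonal_continuous (phi : R -> R) x : continuous phi ->
  continuous (fun t => phi (dot x t)).
Proof. by move=> cphi t; apply: continuous_comp;
  [exact: dot_continuous|exact: cphi]. Qed.

Lemma mulr_fun_continuous (T : topologicalType) (f g : T -> R) :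
  continuous f -> continuous g -> continuous (fun s => f s * g s).
Proof. by move=> cf cg t; apply: cvgM; [exact: cf|exact: cg]. Qed.

Lemma addr_fun_continuous (T : topologicalType) (f g : T -> R) :
  continuous f -> continuous g -> continuous (fun s => f s + g s).
Proof. by move=> cf cg t; apply: cvgD; [exact: cf|exact: cg]. Qed.

Lemma subr_fun_continuous (T : topologicalType) (f g : T -> R) :
  continuous f -> continuous g -> continuous (fun s => f s - g s).
Proof. by move=> cf cg t; apply: cvgB; [exact: cf|exact: cg]. Qed.

Lemma exp_zonal_continuous x m : continuous (fun t => dot x t ^+ m).
Proof. by apply: (zonal_continuous (phi := fun u => u ^+ m));
  exact: exprn_continuous. Qed.

Lemma smean_zonal (phi : R -> R) x y : continuous phi -> sphere R p x -> sphere R p y ->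
  smean (fun t => phi (dot x t)) = smean (fun t => phi (dot y t)).
Proof.
move=> cphi Sx Sy; have [Q QQ xQ] := orthogonal_transitive Sx Sy.
rewrite -(smean_orthogonal hnu QQ (zonal_continuous (x := y) cphi)).
by apply: eq_smean => t _; rewrite dot_mulmx -xQ -mulmxA QQ mulmx1.
Qed.

Variable e : 'rV[R]_p.
Hypothesis Se : sphere R p e.

Definition zonal_moment m := smean (fun t => dot e t ^+ m).

(** Homogeneity reduces a nonzero x to a unit vector, and transitivity of the orthogonal group then
    reduces it to [e]. At x = 0 the convention 0^0 = 1 makes N = 0 consistent. *)
Lemma smean_exp_dot x N :
  smean (fun t => dot x t ^+ N.*2) = zonal_moment N.*2 * dot x x ^+ N.
Proof.
have [->|x0] := eqVneq x 0.
  have d0 t : dot 0 t = 0 by rewrite -[0](scale0r 0) dotZl mul0r.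
  rewrite d0; case: N => [|N].
    rewrite expr0 mulr1 /zonal_moment; apply: eq_smean => t _.
    by rewrite !expr0.
  rewrite expr0n mulr0 -[RHS](smean_cst hnu 0); apply: eq_smean => t _.
  by rewrite d0 doubleS expr0n.
set r := Num.sqrt (dot x x).
have r2 : r ^+ 2 = dot x x by rewrite sqr_sqrtr ?dot_ge0.
have r0 : r != 0 by rewrite -sqrf_eq0 r2 dot_eq0.
have Sx : sphere R p (r^-1 *: x).
  by apply/sphereE; rewrite dotZl dotZr -r2; field.
rewrite /zonal_moment (smean_zonal (phi := fun u =>
  u ^+ N.*2) (@exprn_continuous _ _) Se Sx)//.
rewrite mulrC -smeanZ//; last exact: exp_zonal_continuous.
apply: eq_smean => t _; rewrite dotZl exprMn mulrA -r2 -exprM mul2n exprVn.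
by rewrite divff ?mul1r// expf_neq0.
Qed.

(** The antipodal map preserves [nu] and multiplies the integrand by (-1)^(i + j). *)
Lemma smean_odd x y i j : odd (i + j) ->
  smean (fun t => dot x t ^+ i * dot y t ^+ j) = 0.
Proof.
move=> oij.
have cf : continuous (fun t => dot x t ^+ i * dot y t ^+ j).
  by apply: mulr_fun_continuous; exact: exp_zonal_continuous.
have QQ : (- 1%:M : 'M[R]_p) *m (- 1%:M)^T = 1%:M.
  by rewrite linearN /= trmx1 mulmxN mulmx1 opprK.
have := smean_orthogonal hnu QQ cf.
rewrite [X in X = _](_ : _ = smean (fun t => -1 * (dot x t ^+ i * dot y t ^+ j))).
  by rewrite (smeanZ nu (-1) cf) => h; lra.
apply: eq_smean => t _; rewrite mulmxN mulmx1 !dotNr.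
by rewrite (exprNn (dot x t)) (exprNn (dot y t)) mulrACA -exprD -signr_odd oij expr1.
Qed.

(** Expand the mean of (t.(x + s y))^(2N) in s. By [smean_exp_dot] it is a constant times |x + s
    y|^(2N), a power of [polar]; equality for every real s forces equality of the coefficients of
    s^j. *)
Lemma polarization x y N j : sphere R p x -> sphere R p y -> (j <= N.*2)%N ->
  'C(N.*2, j)%:R * smean (fun t => dot x t ^+ (N.*2 - j) * dot y t ^+ j) =
  zonal_moment N.*2 * ((polar ^+ N)`_j).[dot x y].
Proof.
move=> Sx Sy jN.
pose P := \poly_(k < N.*2.+1) ('C(N.*2, k)%:R *
  smean (fun t => dot x t ^+ (N.*2 - k) * dot y t ^+ k)).
pose Q := zonal_moment N.*2 *: map_poly (horner_eval (dot x y)) (polar ^+ N).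
suff PQ : P = Q.
  have := congr1 (fun h : {poly R} => h`_j) PQ.
  by rewrite /P /Q coef_poly ltnS jN coefZ coef_map.
apply: eq_horner_poly => s.
transitivity (smean (fun t => dot (x + s *: y) t ^+ N.*2)).
  rewrite /P horner_poly.
  transitivity (smean (fun t => \sum_(k < N.*2.+1)
      ('C(N.*2, k)%:R * s ^+ k) * (dot x t ^+ (N.*2 - k) * dot y t ^+ k))).
    rewrite (smean_sum hnu).
      apply: eq_bigr => k _; rewrite (smeanZ nu) 1?mulrAC//.
      by apply: mulr_fun_continuous; exact: exp_zonal_continuous.
    move=> k; apply: mulr_fun_continuous; first exact: cst_continuous.
    by apply: mulr_fun_continuous; exact: exp_zonal_continuous.
  apply: eq_smean => t _; rewrite dotDl dotZl exprDn; apply: eq_bigr => k _.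
  by rewrite exprMn -mulr_natl; ring.
rewrite smean_exp_dot /Q hornerZ; congr (_ * _).
rewrite rmorphXn /= horner_exp; congr (_ ^+ _).
move/sphereE : Sx => Sx; move/sphereE : Sy => Sy.
rewrite /polar 2!rmorphD rmorphM /= rmorph1 map_polyXn map_polyX map_polyC /=.
rewrite !(hornerD, hornerM, hornerX, hornerC, hornerXn, horner_evalE, hornerMn).
by rewrite !(dotDl, dotDr, dotZl, dotZr) Sx Sy (dotC y x); ring.
Qed.

Lemma sum_sqr_sphere x : sphere R p x -> \sum_i x ord0 i ^+ 2 = 1.
Proof. by move=> /sphereE <-. Qed.

Lemma sphere_delta i : sphere R p (delta_mx ord0 i).
Proof. by apply/sphereE; rewrite dot_delta mxE !eqxx. Qed.

(** Insert the factor 1 = |t|^2, the sum of (t.e_i)^2 over the standard basis, and read each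
    resulting mean off the coefficient of s^2 in [polarization] with exponent N + 1. *)
Lemma zonal_momentSS N : N.*2.+1%:R * zonal_moment N.*2 =
  (p + N.*2)%:R * zonal_moment N.*2.+2.
Proof.
have h i : 'C(N.+1.*2, 2)%:R *
    smean (fun t => dot e t ^+ N.*2 * dot (delta_mx ord0 i) t ^+ 2) =
    zonal_moment N.*2.+2 * (N.+1%:R + 2 * N.+1%:R * N%:R * e ord0 i ^+ 2).
  have /(_ isT) := @polarization e (delta_mx ord0 i) N.+1 2 Se (sphere_delta i).
  rewrite doubleS subSS subSS subn0 => ->.
  have [_ _ ->] := coef_exp_polar012 R N.+1.
  by rewrite dot_delta !hornerE -[in N.+1%:R - 1]natr1 addrK; ring.
have bin : 'C(N.+1.*2, 2)%:R = N.+1%:R * N.*2.+1%:R :> R.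
  have e1 : N.+1.*2.-1 = N.*2.+1 by rewrite doubleS.
  by rewrite bin2 e1 -[N.+1.*2]mul2n -mulnA mul2n doubleK natrM.
have H : \sum_i smean (fun t =>
  dot e t ^+ N.*2 * dot (delta_mx ord0 i) t ^+ 2) = zonal_moment N.*2.
  rewrite -(smean_sum hnu) => [|i].
    apply: eq_smean => t St; rewrite -mulr_sumr -[RHS]mulr1; congr (_ * _).
    rewrite -(sum_sqr_sphere St); apply: eq_bigr => i _.
    by rewrite dotC dot_delta.
  by apply: mulr_fun_continuous; exact: exp_zonal_continuous.
have h2 : 'C(N.+1.*2, 2)%:R * zonal_moment N.*2 =
    zonal_moment N.*2.+2 * (p%:R * N.+1%:R + 2 * N.+1%:R * N%:R).
  rewrite -H mulr_sumr (eq_bigr _ (fun i _ => h i)) -mulr_sumr big_split /= -mulr_sumr.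
  by rewrite (sum_sqr_sphere Se) sumr_const card_ord mulr1 -[_ *+ p]mulr_natl.
rewrite bin in h2.
have n0 : N.+1%:R != 0 :> R by rewrite pnatr_eq0.
apply: (mulfI n0); rewrite mulrA h2 natrD -mul2n natrM.
by ring.
Qed.

Lemma zonal_momentE m : zonal_moment m = gegmom a m.
Proof.
elim/ltn_ind: m => -[|[|m]] IH.
- rewrite /= -(smean_cst hnu 1); apply: eq_smean => t _; exact: expr0.
- have := @smean_odd e e 1 0 isT; rewrite /zonal_moment /= => <-.
  by apply: eq_smean => t _; rewrite expr0 mulr1.
have [om|em] := boolP (odd m).
  have -> : zonal_moment m.+2 = 0.
    have <- := @smean_odd e e m.+2 0; last by rewrite addn0 /= negbK.
    by apply: eq_smean => t _; rewrite expr0 mulr1.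
  rewrite /= -(IH m (leqnSn _)).
  suff -> : zonal_moment m = 0 by rewrite mulr0.
  have <- := @smean_odd e e m 0; last by rewrite addn0.
  by apply: eq_smean => t _; rewrite expr0 mulr1.
have := zonal_momentSS m./2; rewrite even_halfK// => h.
rewrite /= -IH//.
have -> : m.+2%:R + 2 * a = (p + m)%:R :> R.
  by rewrite /a natrD -[m.+2]addn2 natrD; field.
have p0 : (p + m)%:R != 0 :> R.
  by rewrite pnatr_eq0 -lt0n addn_gt0 (leq_trans _ p_ge2).
by rewrite mulrAC h mulrAC divff ?mul1r.
Qed.

Lemma smean_exp_exp x y i j : sphere R p x -> sphere R p y ->
  smean (fun t => dot x t ^+ i * dot y t ^+ j) = (zconv a i j).[dot x y].
Proof.
move=> Sx Sy; rewrite /zconv; case: ifPn => [/smean_odd->|eij];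
  first by rewrite horner0.
have eN : (i + j)%N = ((i + j)./2).*2 by rewrite even_halfK.
have := @polarization x y (i + j)./2 j Sx Sy; rewrite -eN leq_addl addnK => /(_ isT).
rewrite zonal_momentE hornerZ => h.
have c0 : 'C(i + j, j)%:R != 0 :> R by rewrite pnatr_eq0 -lt0n bin_gt0 leq_addl.
by rewrite mulrAC -h mulrAC divff ?mul1r.
Qed.

Lemma horner_zonal_continuous (f : {poly R}) x : continuous (fun t => f.[dot x t]).
Proof. exact: zonal_continuous (@continuous_horner R f). Qed.

Lemma smean_horner x (f : {poly R}) : sphere R p x ->
  smean (fun t => f.[dot x t]) = gegL a f.
Proof.
move=> Sx; elim/(@poly_lin_ind R): f => [n|c f g hf hg].
  rewrite gegLXn -zonal_momentE /zonal_moment (smean_zonal (phi := fun u =>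
    u ^+ n) (@exprn_continuous _ _) Se Sx).
  by apply: eq_smean => t _; rewrite hornerXn.
rewrite linearP /= -hf -hg -(smeanZ nu); last exact: horner_zonal_continuous.
rewrite -(smeanD nu); last 2 first.
- by apply: mulr_fun_continuous; [exact: cst_continuous|exact: horner_zonal_continuous].
- exact: horner_zonal_continuous.
by apply: eq_smean => t _; rewrite hornerD hornerZ.
Qed.

Lemma smean_horner_exp x y (f : {poly R}) j : sphere R p x -> sphere R p y ->
  smean (fun t => f.[dot x t] * dot y t ^+ j) = (zconvL a j f).[dot x y].
Proof.
move=> Sx Sy; elim/(@poly_lin_ind R): f => [n|c f g hf hg].
  rewrite zconvLXn -smean_exp_exp//.
  by apply: eq_smean => t _; rewrite hornerXn.
have cfg (h : {poly R}) : continuous (fun t => h.[dot x t] * dot y t ^+ j).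
  by apply: mulr_fun_continuous;
    [exact: horner_zonal_continuous|exact: exp_zonal_continuous].
rewrite linearP /= hornerD hornerZ -hf -hg -(smeanZ nu)//.
rewrite -(smeanD nu)//; last by apply: mulr_fun_continuous => //; exact: cst_continuous.
by apply: eq_smean => t _; rewrite hornerD hornerZ mulrDl mulrA.
Qed.

Lemma funk_hecke x y (g : {poly R}) k : sphere R p x -> sphere R p y ->
  smean (fun t => (zgeg a k).[dot x t] * g.[dot y t]) =
  gegL a (zgeg a k * g) * (zgeg a k).[dot x y].
Proof.
move=> Sx Sy; elim/(@poly_lin_ind R): g => [n|c f g hf hg].
  transitivity (smean (fun t => (zgeg a k).[dot x t] * dot y t ^+ n)).
    by apply: eq_smean => t _; rewrite hornerXn.
  rewrite smean_horner_exp// zconvL_zgeg ?gegindex_ge0// hornerZ; congr (_ * _).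
  (* The scalar is a value at 1 = x.x, hence a mean with y = x, where both factors depend on x.t
     only. *)
  have /sphereE xx := Sx; rewrite -{1}xx -(smean_horner_exp _ _ Sx Sx).
  rewrite -(smean_horner _ Sx); apply: eq_smean => t _.
  by rewrite hornerM hornerXn.
have cfg (h : {poly R}) : continuous (fun t => (zgeg a k).[dot x t] * h.[dot y t]).
  by apply: mulr_fun_continuous; exact: horner_zonal_continuous.
rewrite mulrDr -scalerAr linearP /= mulrDl -mulrA -hf -hg -(smeanZ nu)//.
rewrite -(smeanD nu)//; last by apply: mulr_fun_continuous => //; exact: cst_continuous.
by apply: eq_smean => t _; rewrite hornerD hornerZ mulrDr mulrCA.
Qed.

End ZonalMoments.

(** * The Gegenbauer weight on [-1, 1] *)

Lemma FTC2_closed (R : realType) (F f : R -> R) (l r : R) : l < r ->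
  (forall x, l <= x <= r -> is_derive x 1 F (f x)) ->
  (forall x, l <= x <= r -> {for x, continuous f}) ->
  (\int[lebesgue_measure]_(x in `[l, r]) (f x)%:E = (F r - F l)%:E)%E.
Proof.
move=> lr dF cf; rewrite EFinB; apply: continuous_FTC2 => //.
- apply: continuous_in_subspaceT => x; rewrite inE /= in_itv /=; exact: cf.
- have cF x : l <= x <= r -> {for x, continuous F}.
    by move=> /dF [d _]; apply: differentiable_continuous; apply/derivable1_diffP.
  split.
  + by move=> x; rewrite in_itv /= => /andP[lx xr]; have [] := dF x; rewrite ?ltW.
  + by apply: cvg_at_right_filter; apply: cF; rewrite lexx ltW.
  + by apply: cvg_at_left_filter; apply: cF; rewrite lexx ltW.
- move=> x; rewrite in_itv /= => /andP[lx xr].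
  by rewrite derive1E; have [_ ->] : is_derive x 1 F (f x) by apply: dF; rewrite !ltW.
Qed.

Section GegenbauerWeight.
Context {R : realType} (a : R).
Hypothesis a_ge0 : 0 <= a.
Implicit Types (f g : {poly R}) (u c : R).
Local Notation mu := (@lebesgue_measure R).

Definition gegw u : R := (1 - u ^+ 2) `^ (a - 2^-1).

Lemma gegw_ge0 u : 0 <= gegw u.
Proof. exact: powR_ge0. Qed.

Let sqr_lt1 u : `|u| < 1 -> 0 < 1 - u ^+ 2.
Proof. by move=> u1; rewrite subr_gt0 -(real_normK (num_real u)) expr_lt1. Qed.

Lemma gegw_gt0 u : `|u| < 1 -> 0 < gegw u.
Proof. by move=> u1; rewrite powR_gt0// sqr_lt1. Qed.

Lemma derive_powR_1sqr c u : `|u| < 1 ->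
  is_derive u 1 (fun v => (1 - v ^+ 2) `^ c) (c * (1 - u ^+ 2) `^ (c - 1) * (- (2 *
    u))).
Proof.
move=> u1; have q0 : 0 < (1 - 'X^2 : {poly R}).[u].
  by rewrite !hornerE sqr_lt1.
have := @is_derive1_comp _ (@powR R ^~ c) (horner (1 - 'X^2)) u _ _ (@is_derive1_powR
  R c _ q0) (is_derive_poly _ _).
rewrite derivB derivXn -polyC1 derivC polyC1 !hornerE => h.
rewrite (_ : (fun v => _) = @powR R ^~ c \o horner (1 - 'X^2)); last first.
  by apply/funext => v /=; rewrite !hornerE.
by apply: is_derive_eq; ring.
Qed.

Lemma derive_gegjac f u : `|u| < 1 ->
  is_derive u 1 (fun v => f.[v] * (1 - v ^+ 2) `^ (a + 2^-1)) ((gegjac a f).[u] *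
    gegw u).
Proof.
move=> u1; have h := derive_powR_1sqr (a + 2^-1) u1.
have hf := is_derive_poly f u.
have := is_deriveM hf h; rewrite /GRing.scale /= => h2.
apply: is_derive_eq.
have q0 := sqr_lt1 u1.
rewrite /gegw (_ : a + 2^-1 - 1 = a - 2^-1); last by field.
have -> : (1 - u ^+ 2) `^ (a + 2^-1) = (1 - u ^+ 2) * (1 - u ^+ 2) `^ (a - 2^-1).
  rewrite -{2}[1 - u ^+ 2]powRr1 ?ltW// -powRD; last first.
    by apply/implyP => _; rewrite gt_eqF.
  by congr (_ `^ _); field.
by rewrite /gegjac -[X in (X - 'X^2) * _]polyC1 !(hornerD, hornerN, hornerM, hornerC,
  hornerX, hornerXn); field.
Qed.

Lemma gegw_continuous u : `|u| < 1 -> {for u, continuous gegw}.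
Proof.
move=> /(derive_powR_1sqr (a - 2^-1)) [d _].
by apply: differentiable_continuous; apply/derivable1_diffP.
Qed.

Lemma measurable_gegw : measurable_fun setT gegw.
Proof.
have h : measurable_fun setT (horner (1 - 'X^2 : {poly R})).
  by apply: continuous_measurable_fun; exact: continuous_horner.
have := measurableT_comp (@measurable_powR R (a - 2^-1)) h.
rewrite (_ : _ \o _ = gegw)//; apply/funext => v.
by rewrite /gegw /= -polyC1 !(hornerD, hornerN, hornerC, hornerXn).
Qed.

Lemma integral_gegjac_closed f c : 0 < c < 1 ->
  (\int[mu]_(u in `[(- c)%R, c]) ((gegjac a f).[u] * gegw u)%:E =
  ((f.[c] - f.[- c]) * (1 - c ^+ 2) `^ (a + 2^-1))%:E)%E.
Proof.
move=> /andP[c0 c1].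
have uc u : - c <= u <= c -> `|u| < 1 by rewrite -ler_norml => /le_lt_trans; exact.
have cc : - c < c by rewrite (lt_trans _ c0)// oppr_lt0.
apply: etrans (@FTC2_closed R (fun v => f.[v] * (1 - v ^+ 2) `^ (a + 2^-1))
  (fun u => (gegjac a f).[u] * gegw u) _ _ cc _ _) _.
- by move=> u /uc; exact: derive_gegjac.
- move=> u /uc u1; apply: cvgM; first exact: continuous_horner.
  exact: gegw_continuous.
- by rewrite sqrrN mulrBl.
Qed.

(** The weight may be singular at both ends, so (-1, 1) is exhausted by compact intervals; the shift
    n + 2 keeps 0 < r < 1 already at n = 0. *)
Let r_ n : R := 1 - n.+2%:R^-1.

Let r_itv n : 0 < r_ n < 1.
Proof.
rewrite subr_gt0 gtrBl invr_gt0 ltr0n andbT invf_lt1 ?ltr0n// ltr1n//.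
Qed.

Let A_ n : set R := `[- r_ n, r_ n]%classic.

Let r_cvg : r_ n @[n --> \oo] --> (1 : R).
Proof.
rewrite -[X in _ --> X]subr0; apply: cvgB; first exact: cvg_cst.
by have := @cvg_harmonic R; rewrite -(@cvg_shiftS R (@harmonic R)).
Qed.

Let A_norm n u : A_ n u -> `|u| < 1.
Proof.
have /andP[_ r1] := r_itv n.
by rewrite /A_ /= in_itv /= -ler_norml => /le_lt_trans; exact.
Qed.

Let A_nondecr : nondecreasing_seq A_.
Proof.
move=> m n mn; apply/subsetPset => u;
  rewrite /A_ /= !in_itv /= -!ler_norml => /le_trans; apply.
by rewrite lerB// lef_pV2 ?posrE ?ltr0n// ler_nat.
Qed.

Let bigcup_A : \bigcup_n A_ n = `](-1), 1[%classic.
Proof.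
apply/seteqP; split => [u [n _ /A_norm]|u]; rewrite /= in_itv /= -ltr_norml// => u1.
have [N _ /(_ N (leqnn N))] : \forall n \near \oo, `|u| < r_ n.
  exact: cvgr_gt r_cvg _ u1.
by move=> uN; exists N => //; rewrite /A_ /= in_itv /= -ler_norml ltW.
Qed.

Let measurable_A n : measurable (A_ n).
Proof. exact: measurable_itv. Qed.

Let integrable_A n (g : R -> R) : (forall u, `|u| < 1 -> {for u, continuous g}) ->
  mu.-integrable (A_ n) (EFin \o g).
Proof.
move=> cg; apply: continuous_compact_integrable; first exact: segment_compact.
by apply: continuous_in_subspaceT => u; rewrite inE => /A_norm; exact: cg.
Qed.

(* From (2a + 1) w = (2a + 2) (1 - u^2) w - gegjac 'X w, whose last term has a
   nonnegative integral; this covers the singular weight of the case p = 2. *)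
Let integral_gegw_A n : (\int[mu]_(u in A_ n) (gegw u)%:E <= 4%:E)%E.
Proof.
have /andP[r0 r1] := r_itv n.
have a1 : 0 < 2 * a + 1 by rewrite ltr_wpDl ?mulr_ge0.
have iw : mu.-integrable (A_ n) (EFin \o (fun u => (2 * a + 1) * gegw u)).
  apply: integrable_A => u u1; apply: cvgM; first exact: cvg_cst.
  exact: gegw_continuous.
have ig : mu.-integrable (A_ n) (EFin \o (fun u => (gegjac a 'X).[u] * gegw u)).
  apply: integrable_A => u u1; apply: cvgM; first exact: continuous_horner.
  exact: gegw_continuous.
have Ad := @integralD _ _ _ mu (A_ n) (measurable_A n) _ _ iw ig.
have igX := integral_gegjac_closed 'X (r_itv n).
have ub : (\int[mu]_(u in A_ n) ((EFin \o (fun u => (2 * a + 1) * gegw u)%R) u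
    + (EFin \o (fun u => (gegjac a 'X).[u] * gegw u)%R) u) <= ((2 * a + 2) * 2)%:E)%E.
  apply: (@le_trans _ _ (\int[mu]_(u in A_ n) (2 * a + 2)%:E)%E).
    apply: le_integral => //.
    - exact: measurable_A.
    - exact: (@integrableD _ _ _ mu (A_ n) (measurable_A n) _ _ iw ig).
    - by apply: (@integrable_A n (fun=> 2 * a + 2)) => u _; exact: cst_continuous.
    move=> u /set_mem/A_norm u1; rewrite /= -EFinD lee_fin.
    have q0 := sqr_lt1 u1.
    have -> : (2 * a + 1) * gegw u + (gegjac a 'X).[u] * gegw u =
      (2 * a + 2) * ((1 - u ^+ 2) * gegw u).
      rewrite /gegjac derivX -[X in (X - 'X^2) * _]polyC1.
      by rewrite !(hornerD, hornerN, hornerM, hornerC, hornerX, hornerXn); ring.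
    (* (1 - u^2) w(u) is (1 - u^2)^(a + 1/2), at most 1 because the exponent is positive. *)
    rewrite ler_piMr ?addr_ge0 ?mulr_ge0// /gegw.
    rewrite -{1}(powRr1 (ltW q0)) -powRD; last first.
      by apply/implyP => _; rewrite gt_eqF.
    rewrite -[leRHS](powRr0 (1 - u ^+ 2)) ger_powR ?q0//=.
      by rewrite lerBlDr lerDl sqr_ge0.
    have : 2^-1 <= 1 :> R by rewrite invf_le1 ?ler1n.
    by lra.
  have muA : (mu (A_ n) <= 2%:E)%E.
    rewrite /A_ lebesgue_measure_itv /= lte_fin gtrN//.
    by rewrite -EFinD lee_fin opprK; lra.
  rewrite integral_cst//; last exact: measurable_A.
  by rewrite EFinM lee_wpmul2l// lee_fin addr_ge0 ?mulr_ge0.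
rewrite Ad in ub.
have lb : (0 <= \int[mu]_(u in A_ n) (EFin \o (fun u =>
  (gegjac a 'X).[u] * gegw u)%R) u)%E.
  rewrite [leRHS]igX lee_fin !hornerX opprK mulr_ge0 ?powR_ge0// addr_ge0// ltW//.
have iZ : (\int[mu]_(u in A_ n) (EFin \o (fun u => (2 * a + 1) * gegw u)%R) u =
   (2 * a + 1)%:E * \int[mu]_(u in A_ n) (gegw u)%:E)%E.
  rewrite -integralZl//.
    exact: measurable_A.
  apply: (@integrable_A n gegw); exact: gegw_continuous.
have : ((2 * a + 1)%:E * \int[mu]_(u in A_ n) (gegw u)%:E <= ((2 * a + 2) * 2)%:E)%E.
  by rewrite -iZ (le_trans _ ub)// leeDl.
move=> h.
have -> : (\int[mu]_(u in A_ n) (gegw u)%:E =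
   ((2 * a + 1)^-1)%:E * ((2 * a + 1)%:E * \int[mu]_(u in A_ n) (gegw u)%:E))%E.
  by rewrite muleA -EFinM mulVf ?gt_eqF// mul1e.
(* The interval has length at most 2, and 2 (2a + 2) <= 4 (2a + 1) since a >= 0: hence the bound 4,
   uniform in n. *)
apply: (@le_trans _ _ (((2 * a + 1)^-1)%:E * ((2 * a + 2) * 2)%:E)%E).
  by rewrite lee_wpmul2l// lee_fin invr_ge0 ltW.
rewrite -EFinM lee_fin mulrC ler_pdivrMr//.
by rewrite -subr_ge0 (_ : _ - _ = 4 * a) ?mulr_ge0//; ring.
Qed.

Let measurable_gegw_sub (D : set R) : measurable_fun D (EFin \o gegw).
Proof. by apply: measurable_funTS; apply/measurable_EFinP; exact: measurable_gegw. Qed.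

(** Monotone convergence along the [A_ n], whose integrals share the bound 4. *)
Let integrable_gegw_oo : mu.-integrable `](-1)%R, 1%R[ (EFin \o gegw).
Proof.
apply/integrableP; split; first exact: measurable_gegw_sub.
have -> : (\int[mu]_(u in `](-1)%R, 1%R[) `|(EFin \o gegw) u| =
    \int[mu]_(u in `](-1)%R, 1%R[) (gegw u)%:E)%E.
  by apply: eq_integral => u _ /=; rewrite ger0_norm// gegw_ge0.
rewrite -bigcup_A.
have h : (\int[mu]_(u in A_ n) (gegw u)%:E)%E @[n --> \oo] -->
    (\int[mu]_(u in \bigcup_n A_ n) (gegw u)%:E)%E.
  apply: ge0_nondecreasing_set_cvg_integral; first exact: A_nondecr.
  - by move=> n; exact: measurable_A.
  - by move=> n; exact: measurable_gegw_sub.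
  by move=> n u _; rewrite lee_fin gegw_ge0.
apply: (@le_lt_trans _ _ 4%:E); last by rewrite ltry.
rewrite -(cvg_lim _ h)//; apply: lime_le; first by apply/cvg_ex; eexists; exact: h.
by apply: nearW => n; exact: integral_gegw_A.
Qed.

Lemma integrable_gegw : mu.-integrable `[(-1)%R, 1%R] (EFin \o gegw).
Proof.
apply/integrableP; split; first exact: measurable_gegw_sub.
rewrite -integral_itv_obnd_cbnd; last by apply: measurableT_comp.
rewrite -integral_itv_bndo_bndc; last by apply: measurableT_comp.
by have /integrableP[] := integrable_gegw_oo.
Qed.

Lemma continuous_bound_itv (f : R -> R) : continuous f ->
  exists2 M, 0 <= M & forall u, -1 <= u <= 1 -> `|f u| <= M.
Proof.
move=> cf; have n11 : (-1 : R) <= 1 by rewrite (le_trans (@lerN10 R)).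
have [|c _ hc] := @EVT_max R (fun u => `|f u|) (-1) 1 n11.
  apply: continuous_subspaceT => u; apply: (@continuous_comp _ _ _ f); first exact: cf.
  exact: norm_continuous.
by exists `|f c| => // u u1; apply: hc; rewrite in_itv.
Qed.

Let measurable_mul_gegw (D : set R) (f : R -> R) : continuous f ->
  measurable_fun D (fun u => (f u * gegw u)%:E).
Proof.
move=> cf; apply/measurable_EFinP; apply: measurable_funTS; apply: measurable_funM.
  exact: continuous_measurable_fun.
exact: measurable_gegw.
Qed.

Lemma integrable_mul_gegw (f : R -> R) : continuous f ->
  mu.-integrable `[(-1)%R, 1%R] (EFin \o (fun u => f u * gegw u)).
Proof.
move=> cf; have [M M0 hM] := continuous_bound_itv cf.
have iMw := @integrableZl _ _ _ mu `[(-1)%R,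
  1%R] (measurable_itv _) M _ integrable_gegw.
apply: (le_integrable _ _ _ iMw); first exact: measurable_itv.
  exact: measurable_mul_gegw.
move=> u; rewrite /= in_itv /= => /hM h; rewrite lee_fin !normrM.
by rewrite ler_wpM2r// (ger0_norm M0).
Qed.

Definition gegI (f : R -> R) : R := \int[mu]_(u in `[(-1)%R, 1%R]) (f u * gegw u).

Let gegI_A f n : (\int[mu]_(u in `](-1)%R, 1%R[)
   ((fun u => ((gegjac a f).[u] * gegw u)%:E) \_ (A_ n)) u =
   ((f.[r_ n] - f.[- r_ n]) * (1 - r_ n ^+ 2) `^ (a + 2^-1))%:E)%E.
Proof.
rewrite -(integral_gegjac_closed f (r_itv n)) -/(A_ n) -integral_mkcondr.
congr (integral _ _ _); rewrite -bigcup_A setIC; apply/setIidl.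
exact: (@bigcup_sup _ _ n).
Qed.

(** The base is at most 1 and the exponent at least 1/2, so the power is squeezed below a square
    root. *)
Let powR_r_cvg0 : (1 - r_ n ^+ 2) `^ (a + 2^-1) @[n --> \oo] --> (0 : R).
Proof.
have h : (1 - r_ n ^+ 2) @[n --> \oo] --> (0 : R).
  have -> : (0 : R) = 1 - 1 ^+ 2 by rewrite expr1n subrr.
  apply: cvgB; first exact: cvg_cst.
  by have := continuous_cvg _ (@exprn_continuous R 2 1) r_cvg; exact.
have s0 : Num.sqrt (1 - r_ n ^+ 2) @[n --> \oo] --> (0 : R).
  by have := continuous_cvg _ (@sqrt_continuous R 0) h; rewrite sqrtr0; exact.
apply: (squeeze_cvgr _ (cvg_cst 0) s0); apply: nearW => n; rewrite powR_ge0/=.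
have /andP[r0 r1] := r_itv n.
have q0 : 0 < 1 - r_ n ^+ 2 by apply: sqr_lt1; rewrite ger0_norm// ltW.
rewrite -powR12_sqrt ?(ltW q0)// ger_powR//; last by rewrite lerDr.
by rewrite q0 lerBlDr lerDl sqr_ge0.
Qed.

(** The primitive f(u) (1 - u^2)^(a + 1/2) vanishes at both ends. The fundamental theorem applies
    only inside (-1, 1), and dominated convergence along the [A_ n] reaches the ends. *)
Lemma gegI_jacobi f : gegI (horner (gegjac a f)) = 0.
Proof.
pose g u := ((gegjac a f).[u] * gegw u)%:E.
have mg D : measurable_fun D g by exact: (measurable_mul_gegw (@continuous_horner _
  (gegjac a f))).
have [_ _ cv] : [/\ mu.-integrable `](-1)%R, 1%R[ g,
    (\int[mu]_(u in `](-1)%R, 1%R[) `|(g \_ (A_ n)) u - g u| @[n --> \oo] --> 0)%E &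
    (\int[mu]_(u in `](-1)%R, 1%R[) (g \_ (A_ n)) u)%E @[n --> \oo] -->
    (\int[mu]_(u in `](-1)%R, 1%R[) g u)%E].
  apply: (@dominated_convergence _ _ _ mu _ _ _ _ (fun u => `|g u|%E)).
  - exact: measurable_itv.
  - move=> n; apply/measurable_restrict => //.
  - exact: measurable_A.
  - exact: mg.
  - exact: mg.
  - apply: aeW => u uD.
    have [N _ uN] : (\bigcup_n A_ n) u by rewrite bigcup_A.
    apply: cvg_near_cst; exists N => // n /= Nn; rewrite patchE mem_set//.
    by move/subsetPset : (A_nondecr Nn); exact.
  - apply: integrable_abse.
    apply: (integrableS _ _ _ (integrable_mul_gegw (@continuous_horner _ (gegjac a
      f)))).
    - exact: measurable_itv.
    - exact: measurable_itv.
    - by apply: subset_itv; rewrite bnd_simp.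
  - apply: aeW => u n _; rewrite patchE; case: ifPn => // _.
    by rewrite abse0.
rewrite /gegI /Rintegral -integral_itv_obnd_cbnd; last exact: mg.
rewrite -integral_itv_bndo_bndc; last exact: mg.
suff -> : (\int[mu]_(u in `](-1)%R, 1%R[) g u = 0)%E by [].
apply: (cvg_unique _ cv) => //.
rewrite (_ : (fun n => _) = (fun n => ((f.[r_ n] - f.[- r_ n]) *
    (1 - r_ n ^+ 2) `^ (a + 2^-1))%:E)); last by apply/funext => n; exact: gegI_A.
apply: cvg_EFin; first by apply: nearW.
have h1 : f.[r_ n] @[n --> \oo] --> f.[1].
  by have := continuous_cvg _ (@continuous_horner _ f 1) r_cvg; exact.
have h2 : f.[- r_ n] @[n --> \oo] --> f.[-1].
  by have := continuous_cvg _ (@continuous_horner _ f (-1)) (cvgN r_cvg); exact.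
by have := cvgM (cvgB h1 h2) powR_r_cvg0; rewrite mulr0; exact.
Qed.

Lemma gegIZ c (f : R -> R) : continuous f -> gegI (fun u => c * f u) = c * gegI f.
Proof.
move=> cf; rewrite /gegI -RintegralZl; last 2 first.
- exact: measurable_itv.
- exact: integrable_mul_gegw.
by apply: eq_Rintegral => u _; rewrite mulrA.
Qed.

Lemma gegID (f g : R -> R) : continuous f -> continuous g ->
  gegI (fun u => f u + g u) = gegI f + gegI g.
Proof.
move=> cf cg; rewrite /gegI -RintegralD; last 3 first.
- exact: measurable_itv.
- exact: integrable_mul_gegw.
- exact: integrable_mul_gegw.
by apply: eq_Rintegral => u _; rewrite mulrDl.
Qed.

Lemma gegI_le (f g : R -> R) : continuous f -> continuous g ->
  (forall u, -1 <= u <= 1 -> f u <= g u) -> gegI f <= gegI g.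
Proof.
move=> cf cg fg; apply: le_Rintegral.
- exact: measurable_itv.
- exact: integrable_mul_gegw.
- exact: integrable_mul_gegw.
by move=> u; rewrite /= in_itv /= => /fg h; rewrite ler_wpM2r// gegw_ge0.
Qed.

Definition gegI1 := gegI (fun=> 1).

Lemma gegI_norm_le (f : R -> R) M : continuous f ->
  (forall u, -1 <= u <= 1 -> `|f u| <= M) -> `|gegI f| <= M * gegI1.
Proof.
move=> cf fM; have c1 : continuous (fun _ : R => 1 : R) by move=> ?;
  exact: cst_continuous.
have cM (c : R) : continuous (fun _ : R => c * 1 : R) by move=> ?;
  exact: cst_continuous.
rewrite ler_norml -mulNr /gegI1 -!gegIZ// !gegI_le// => u /fM;
  by rewrite mulr1 ler_norml => /andP[].
Qed.

Lemma gegI1_gt0 : 0 < gegI1.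
Proof.
have /andP[r0 r1] := r_itv 0.
have rr : - r_ 0 <= r_ 0 by rewrite (le_trans _ (ltW r0))// oppr_le0 ltW.
have [|c cA hc] := @EVT_min R gegw (- r_ 0) (r_ 0) rr.
  by apply: continuous_in_subspaceT => u; rewrite inE => /A_norm;
    exact: gegw_continuous.
have c0 : 0 < gegw c by apply: gegw_gt0; apply: (@A_norm 0); rewrite /A_ /=.
have iw : mu.-integrable (A_ 0) (EFin \o gegw) by apply: integrable_A;
  exact: gegw_continuous.
have h : \int[mu]_(u in A_ 0) gegw c <= \int[mu]_(u in A_ 0) gegw u.
  apply: le_Rintegral.
  - exact: measurable_A.
  - by apply: (@integrable_A 0 (fun=> gegw c)) => u _; exact: cst_continuous.
  - exact: iw.
  - by move=> u uA; apply: hc; exact: uA.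
have h2 : \int[mu]_(u in A_ 0) gegw u <= gegI1.
  rewrite /gegI1 /gegI /Rintegral fine_le//.
  - by apply: integrable_fin_num => //; exact: measurable_A.
  - apply: integrable_fin_num; first exact: measurable_itv.
    by apply: (@integrable_mul_gegw (fun=> 1)) => u; exact: cst_continuous.
  rewrite [leRHS](_ : _ = (\int[mu]_(u in `[(-1)%R, 1%R]) (gegw u)%:E)%E); last first.
    by apply: eq_integral => u _; rewrite mul1r.
  apply: ge0_subset_integral.
  - exact: measurable_A.
  - exact: measurable_itv.
  - exact: measurable_gegw_sub.
  - by move=> u _; rewrite lee_fin gegw_ge0.
  - by move=> u /A_norm; rewrite /= in_itv /= => /ltW; rewrite ler_norml.
have muA : mu (A_ 0) = (r_ 0 + r_ 0)%:E.
  by rewrite /A_ lebesgue_measure_itv /= lte_fin gtrN// -EFinD opprK.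
apply: lt_le_trans h2; apply: lt_le_trans h.
rewrite Rintegral_cst; last exact: measurable_A.
apply: mulr_gt0 => //; rewrite [X in fine X](_ : _ = (r_ 0 + r_ 0)%:E); last exact: muA.
exact: addr_gt0.
Qed.

(** [gegI_jacobi] at X^(n+1) is the recurrence of [gegmom], so the moments agree up to the total
    mass. *)
Lemma gegI_horner f : gegI (horner f) = gegI1 * gegL a f.
Proof.
have c_h := @continuous_horner R.
have gegIL c g h : gegI (horner (c *: g + h)) = c * gegI (horner g) + gegI (horner h).
  rewrite -gegIZ// -gegID//; last first.
    move=> u; apply: cvgM; [exact: cvg_cst|exact: c_h].
  by congr gegI; apply/funext => u; rewrite hornerD hornerZ.
elim/(@poly_lin_ind R): f => [n|c g h hg hh]; last first.
  by rewrite gegIL hg hh linearP /=; ring.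
rewrite gegLXn.
have X1 : gegI (horner 1) = gegI1.
  by congr gegI; apply/funext => u; rewrite hornerC.
have X0 : gegI (horner 0) = 0.
  rewrite -[RHS](mul0r gegI1) -X1 -gegIZ//; congr gegI.
  by apply/funext => u; rewrite horner0 mul0r.
elim/ltn_ind: n => -[|[|n]] IH.
- by rewrite expr0 X1 mulr1.
- have := gegI_jacobi 1.
  rewrite /gegjac (_ : _ - _ = (- (2 * a + 1)) *: 'X + 0); last first.
    by rewrite -mul_polyC -polyC1 derivC; ring.
  rewrite gegIL X0 addr0 => /eqP;
    rewrite mulf_eq0 oppr_eq0 gt_eqF ?ltr_wpDl ?mulr_ge0//=.
  by move/eqP => ->; rewrite mulr0.
have := gegI_jacobi 'X^(n.+1).
rewrite /gegjac (_ : _ - _ =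
  (- (n.+2%:R + 2 * a)) *: 'X^(n.+2) + (n.+1%:R *: 'X^n + 0)); last first.
  by rewrite -!mul_polyC derivXn /= -mulr_natl !exprS; ring.
rewrite 2!gegIL (IH n)// X0 addr0 mulNr => /eqP; rewrite addrC subr_eq0 => /eqP h.
have hn : n.+2%:R + 2 * a != 0 by rewrite gt_eqF// ltr_wpDr// mulr_ge0.
apply: (mulfI hn); rewrite -h /=; field.
by rewrite -natrD.
Qed.

End GegenbauerWeight.

(** * The Gamma function *)

Section GammaFunction.
Context {R : realType}.
Implicit Types (x t : R) (n : nat).
Local Notation mu := (@lebesgue_measure R).

Definition gammaf x t : R := t `^ (x - 1) * expR (- t).

(** Extended-real values allow the functional equation to be proved before finiteness is known. *)
Definition eGamma x : \bar R := (\int[mu]_(t in `]0%R, +oo[) (gammaf x t)%:E)%E.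

Lemma Gamma_eGamma x : Gamma x = fine (eGamma x).
Proof. by []. Qed.

Lemma gammaf_ge0 x t : 0 <= gammaf x t.
Proof. by rewrite mulr_ge0 ?powR_ge0 ?expR_ge0. Qed.

Lemma measurable_gammaf x (D : set R) : measurable_fun D (EFin \o gammaf x).
Proof.
apply/measurable_EFinP; apply: measurable_funTS; apply: measurable_funM.
  exact: measurable_powR.
apply: continuous_measurable_fun => t.
by have := continuous_cvg _ (@continuous_expR R (- t)) (@oppr_continuous _ _ t); exact.
Qed.

Lemma derive_powR_expN x t : 0 < t ->
  is_derive t 1 (fun s => s `^ x * expR (- s)) (x * gammaf x t - gammaf (x + 1) t).
Proof.
move=> t0; have h1 := @is_derive1_powR R x t t0.
have h2 := is_derive1_comp (is_derive_expR (- t)) (is_deriveNid t 1).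
have := is_deriveM h1 h2; rewrite /GRing.scale /= => h.
apply: is_derive_eq; rewrite /gammaf addrK; ring.
Qed.

Lemma gammaf_continuous x t : 0 < t -> {for t, continuous (gammaf x)}.
Proof.
move=> /(derive_powR_expN (x - 1)) [d _].
by apply: differentiable_continuous; apply/derivable1_diffP.
Qed.

Let A_ n : set R := `[n.+2%:R^-1, n.+2%:R]%classic.

Let A_gt0 n t : A_ n t -> 0 < t.
Proof. by rewrite /A_ /= in_itv /= => /andP[h _];
  rewrite (lt_le_trans _ h)// invr_gt0 ltr0n. Qed.

Let lt_inv n : n.+2%:R^-1 < n.+2%:R :> R.
Proof.
by rewrite (@lt_trans _ _ 1)// ?ltr1n// invf_lt1 ?ltr0n ?ltr1n.
Qed.

Let A_nondecr : nondecreasing_seq A_.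
Proof.
move=> m n mn; apply/subsetPset => u; rewrite /A_ /= !in_itv /= => /andP[h1 h2].
rewrite (le_trans _ h1) ?(le_trans h2) ?ler_nat ?ltnS//.
by rewrite lef_pV2 ?posrE ?ltr0n// ler_nat !ltnS.
Qed.

Let bigcup_A : \bigcup_n A_ n = `]0%R, +oo[%classic.
Proof.
apply/seteqP; split => [u [n _ /A_gt0]|u]; rewrite /= in_itv /= andbT// => u0.
pose N := maxn (Num.truncn u) (Num.truncn u^-1).
exists N => //; rewrite /A_ /= in_itv /=; apply/andP; split.
  rewrite -[leRHS]invrK lef_pV2 ?posrE ?ltr0n ?invr_gt0//.
  rewrite (le_trans (ltW (truncnS_gt _)))// ler_nat ltnS.
  by rewrite (leq_trans (leq_maxr (Num.truncn u) _)).
rewrite (le_trans (ltW (truncnS_gt _)))// ler_nat ltnS.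
by rewrite (leq_trans (leq_maxl _ (Num.truncn u^-1))).
Qed.

Let measurable_A n : measurable (A_ n).
Proof. exact: measurable_itv. Qed.

Let integrable_A n (g : R -> R) : (forall t, 0 < t -> {for t, continuous g}) ->
  mu.-integrable (A_ n) (EFin \o g).
Proof.
move=> cg; apply: continuous_compact_integrable; first exact: segment_compact.
by apply: continuous_in_subspaceT => u; rewrite inE => /A_gt0; exact: cg.
Qed.

Let gammaA x n : R := \int[mu]_(t in A_ n) gammaf x t.

Let gammaA_cvg x : (gammaA x n)%:E @[n --> \oo] --> eGamma x.
Proof.
have h : (\int[mu]_(t in A_ n) (gammaf x t)%:E)%E @[n --> \oo] -->
    (\int[mu]_(t in \bigcup_n A_ n) (gammaf x t)%:E)%E.
  apply: ge0_nondecreasing_set_cvg_integral; first exact: A_nondecr.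
  - by move=> n; exact: measurable_A.
  - by move=> n; exact: measurable_gammaf.
  - by move=> n t _; rewrite lee_fin gammaf_ge0.
rewrite bigcup_A in h.
rewrite (_ : (fun n => _) = (fun n => (\int[mu]_(t in A_ n) (gammaf x t)%:E)%E))//.
apply/funext => n; rewrite /gammaA /Rintegral fineK//.
apply: integrable_fin_num; first exact: measurable_A.
by apply: integrable_A; exact: gammaf_continuous.
Qed.

Let bd x t : R := t `^ x * expR (- t).

Let gammaA_rec x n :
  x * gammaA x n - gammaA (x + 1) n = bd x n.+2%:R - bd x n.+2%:R^-1.
Proof.
have ix y : mu.-integrable (A_ n) (EFin \o gammaf y).
  by apply: integrable_A; exact: gammaf_continuous.
rewrite /gammaA -RintegralZl; last 2 first.
- exact: measurable_A.
- exact: ix.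
have ixx : mu.-integrable (A_ n) (EFin \o (fun t => x * gammaf x t)).
  apply: integrable_A => t t0; apply: cvgM; first exact: cvg_cst.
  exact: gammaf_continuous.
rewrite -RintegralB; last 3 first.
- exact: measurable_A.
- exact: ixx.
- exact: ix.
rewrite /Rintegral -[RHS]/(fine (bd x n.+2%:R - bd x n.+2%:R^-1)%:E); congr fine.
apply: (@FTC2_closed R (bd x) _ _ _ (lt_inv n)) => t tA.
  by apply: derive_powR_expN; apply: (@A_gt0 n); rewrite /A_ /= in_itv.
have t0 : 0 < t by apply: (@A_gt0 n); rewrite /A_ /= in_itv.
apply: cvgB; last exact: gammaf_continuous.
apply: cvgM; first exact: cvg_cst.
exact: gammaf_continuous.
Qed.

Let inv_cvg0 : n.+2%:R^-1 @[n --> \oo] --> (0 : R).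
Proof. by have := @cvg_harmonic R; rewrite -(@cvg_shiftS R (@harmonic R)). Qed.

(** At infinity, t^x <= t^N with N > x and e^t >= t^(N+1) / (N+1)! leave the bound (N+1)! / t. At 0
    the factor t^x already tends to 0. *)
Let bd_cvg x : 0 < x -> bd x n.+2%:R - bd x n.+2%:R^-1 @[n --> \oo] --> (0 : R).
Proof.
move=> x0; rewrite -[X in _ --> X]subr0; apply: cvgB.
  pose N := (Num.truncn x).+1; pose c : R := (N.+1)`!%:R.
  have h : c * n.+2%:R^-1 @[n --> \oo] --> (0 : R).
    by have := cvgM (cvg_cst c) inv_cvg0; rewrite mulr0; exact.
  apply: (squeeze_cvgr _ (cvg_cst 0) h); apply: nearW => n.
  rewrite mulr_ge0 ?powR_ge0 ?expR_ge0//=.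
  have t0 : 0 < n.+2%:R :> R by rewrite ltr0n.
  have t1 : 1 <= n.+2%:R :> R by rewrite ler1n.
  apply: (@le_trans _ _ (n.+2%:R ^+ N * expR (- n.+2%:R))).
    rewrite ler_wpM2r ?expR_ge0// -powR_mulrn ?(ltW t0)//.
    by rewrite ler_powR// (ltW (truncnS_gt _)).
  rewrite expRN ler_pdivrMr ?expR_gt0//.
  have c0 : 0 < c by rewrite ltr0n fact_gt0.
  have h1 : n.+2%:R ^+ N.+1 / c <= expR n.+2%:R.
    by apply: le_trans (@expR_ge1Dxn R n.+2%:R N (ltW t0)); rewrite lerDr.
  have -> : n.+2%:R ^+ N = c / n.+2%:R * (n.+2%:R ^+ N.+1 / c) :> R.
    by rewrite exprS; field; rewrite !gt_eqF//= -natrD.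
  by rewrite ler_wpM2l// divr_ge0// ltW.
have h0 : (n.+2%:R^-1 : R) `^ x @[n --> \oo] --> (0 : R).
  have /cvg_at_rightP := @powR_cvg0 R x x0; apply.
  by split; [move=> n; rewrite invr_gt0 ltr0n|exact: inv_cvg0].
apply: (squeeze_cvgr _ (cvg_cst 0) h0); apply: nearW => n.
rewrite mulr_ge0 ?powR_ge0 ?expR_ge0//= ler_piMr ?powR_ge0//.
Qed.

(** Integration by parts on each [A_ n] ([gammaA_rec]); the boundary terms tend to 0. *)
Lemma eGammaS x : 0 < x -> (x%:E * eGamma x = eGamma (x + 1))%E.
Proof.
move=> x0.
have h1 : (x%:E * (gammaA x n)%:E)%E @[n --> \oo] --> (x%:E * eGamma x)%E.
  by apply: cvgeZl => //; exact: gammaA_cvg.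
have h2 : ((gammaA (x + 1) n)%:E + (bd x n.+2%:R - bd x n.+2%:R^-1)%:E)%E @[n --> \oo]
    --> (eGamma (x + 1) + 0%:E)%E.
  apply: cvgeD; first exact: fin_num_adde_defl.
    exact: gammaA_cvg.
  by apply: cvg_EFin; [apply: nearW|exact: bd_cvg].
rewrite adde0 in h2; apply: (cvg_unique _ h1) => //.
rewrite (_ : (fun n => _) = (fun n =>
  ((gammaA (x + 1) n)%:E + (bd x n.+2%:R - bd x n.+2%:R^-1)%:E)%E))//.
by apply/funext => n; rewrite -gammaA_rec -EFinD addrC subrK.
Qed.

Lemma eGamma1 : eGamma 1 = 1%E.
Proof.
have h := @gammaA_cvg 1; apply: (cvg_unique _ h) => //.
have -> : gammaA 1 = (fun n => expR (- n.+2%:R^-1) - expR (- n.+2%:R)).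
  apply/funext => n; rewrite /gammaA /Rintegral.
  transitivity (fine (- expR (- n.+2%:R) - - expR (- n.+2%:R^-1) : R)%:E); last first.
    by rewrite /= opprK addrC.
  congr fine; apply: (@FTC2_closed R (fun t =>
    - expR (- t)) (gammaf 1) _ _ (lt_inv n)) => t tA.
    have h2 := is_derive1_comp (is_derive_expR (- t)) (is_deriveNid t 1).
    have := is_deriveN h2 => h3; apply: is_derive_eq.
    by rewrite /gammaf subrr powRr0; ring.
  by apply: gammaf_continuous; apply: (@A_gt0 n); rewrite /A_ /= in_itv.
apply: cvg_EFin; first exact: nearW.
rewrite -[X in _ --> X]subr0; apply: cvgB.
  have := continuous_cvg _ (@continuous_expR R (- 0)) (cvgN inv_cvg0).
  by rewrite oppr0 expR0; exact.
by have := @cvgn_expR R; rewrite -(@cvg_shiftS R (fun n => expR (- n%:R)))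
  -(@cvg_shiftS R (fun n => expR (- n.+1%:R))).
Qed.

Lemma eGamma_ge0 x : (0 <= eGamma x)%E.
Proof. by apply: integral_ge0 => t _; rewrite lee_fin gammaf_ge0. Qed.

Lemma eGamma_nat n : eGamma n.+1%:R = n`!%:R%:E.
Proof.
elim: n => [|n IH]; first by rewrite eGamma1.
by rewrite -natr1 -eGammaS ?ltr0n// IH -EFinM factS natrM.
Qed.

(* t^x <= 1 + t^N bounds Gamma(x + 1); the functional equation in the extended
   reals then gives finiteness at x as well. *)
Lemma eGamma_fin_num x : 0 < x -> eGamma x \is a fin_num.
Proof.
move=> x0; pose N := (Num.truncn x).+1.
have h : (eGamma (x + 1) <= eGamma 1 + eGamma N.+1%:R)%E.
  rewrite -ge0_integralD//=; last 4 first.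
  - by move=> t _; rewrite lee_fin gammaf_ge0.
  - exact: measurable_gammaf.
  - by move=> t _; rewrite lee_fin gammaf_ge0.
  - exact: measurable_gammaf.
  apply: ge0_le_integral => //.
  - by move=> t _; rewrite lee_fin gammaf_ge0.
  - exact: measurable_gammaf.
  - by apply: emeasurable_funD; exact: measurable_gammaf.
  move=> t; rewrite /= in_itv /= andbT => t0; rewrite -EFinD lee_fin /gammaf -mulrDl.
  rewrite ler_wpM2r ?expR_ge0// subrr powRr0 addrK -natr1 addrK.
  have [t1|t1] := leP t 1.
    rewrite (@le_trans _ _ 1)//; last by rewrite lerDl powR_ge0.
    by rewrite -[leRHS](powRr0 t) ger_powR ?t0// ltW.
  rewrite (@le_trans _ _ (t `^ N%:R))//; last by rewrite lerDr.
  by rewrite ler_powR ?ltW// truncnS_gt.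
have -> : eGamma x = (x^-1%:E * eGamma (x + 1))%E.
  by rewrite -eGammaS// muleA -EFinM mulVf ?gt_eqF// mul1e.
rewrite fin_numM// ge0_fin_numE ?eGamma_ge0// (le_lt_trans h)//.
by rewrite eGamma1 eGamma_nat -EFinD ltry.
Qed.

Lemma GammaS x : 0 < x -> Gamma (x + 1) = x * Gamma x.
Proof.
by move=> x0; rewrite !Gamma_eGamma -eGammaS// fineM// eGamma_fin_num.
Qed.

Lemma Gamma_gt0 x : 0 < x -> 0 < Gamma x.
Proof.
move=> x0; have [|c cA hc] := @EVT_min R (gammaf x) _ _ (ltW (lt_inv 0)).
  by apply: continuous_in_subspaceT => u; rewrite inE => /A_gt0;
    exact: gammaf_continuous.
have c0 : 0 < gammaf x c.
  by rewrite mulr_gt0 ?expR_gt0// powR_gt0//; apply: (@A_gt0 0); rewrite /A_ /=.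
have h : \int[mu]_(u in A_ 0) gammaf x c <= \int[mu]_(u in A_ 0) gammaf x u.
  apply: le_Rintegral.
  - exact: measurable_A.
  - by apply: (@integrable_A 0 (fun=> gammaf x c)) => u _; exact: cst_continuous.
  - by apply: integrable_A; exact: gammaf_continuous.
  - by move=> u uA; apply: hc; exact: uA.
have h2 : \int[mu]_(u in A_ 0) gammaf x u <= Gamma x.
  rewrite Gamma_eGamma /Rintegral fine_le ?eGamma_fin_num//.
  - apply: integrable_fin_num; first exact: measurable_A.
    by apply: integrable_A; exact: gammaf_continuous.
  apply: ge0_subset_integral.
  - exact: measurable_A.
  - exact: measurable_itv.
  - exact: measurable_gammaf.
  - by move=> u _; rewrite lee_fin gammaf_ge0.
  - by move=> u /A_gt0; rewrite /= in_itv /= andbT.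
have muA : mu (A_ 0) = (2 - 2^-1)%:E.
  by rewrite /A_ lebesgue_measure_itv /= lte_fin (lt_inv 0) -EFinD.
apply: lt_le_trans h2; apply: lt_le_trans h.
rewrite Rintegral_cst; last exact: measurable_A.
apply: mulr_gt0 => //; rewrite [X in fine X](_ : _ = (2 - 2^-1)%:E); last exact: muA.
by rewrite /= subr_gt0; exact: (lt_inv 0).
Qed.

Lemma Gamma_nat n : Gamma n.+1%:R = n`!%:R :> R.
Proof. by rewrite Gamma_eGamma eGamma_nat. Qed.

End GammaFunction.

(** * The Laplacian of the exponential *)

Section RealDerivatives.
Context {R : realType}.
Implicit Types (f g s q : R -> R) (h c : R).

Lemma is_derive_mul f g h (f' g' : R) : is_derive h 1 f f' -> is_derive h 1 g g' ->
  is_derive h 1 (fun x => f x * g x) (f h * g' + g h * f').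
Proof. by move=> df dg; have := is_deriveM df dg; exact. Qed.

Lemma is_derive_add f g h (f' g' : R) : is_derive h 1 f f' -> is_derive h 1 g g' ->
  is_derive h 1 (fun x => f x + g x) (f' + g').
Proof. by move=> df dg; have := is_deriveD df dg; exact. Qed.

Lemma is_derive_scale c f h (f' : R) : is_derive h 1 f f' ->
  is_derive h 1 (fun x => c * f x) (c * f').
Proof. by move=> df; have := is_deriveZ c df; exact. Qed.

Lemma is_derive_pow s c h (s' : R) : 0 < s h -> is_derive h 1 s s' ->
  is_derive h 1 (fun x => s x `^ c) (c * s h `^ (c - 1) * s').
Proof. by move=> s0 ds; have := is_derive1_comp (@is_derive1_powR R c _ s0) ds;
  exact. Qed.

Lemma is_derive_exp f h (f' : R) : is_derive h 1 f f' ->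
  is_derive h 1 (fun x => expR (f x)) (expR (f h) * f').
Proof. by move=> df; have := is_derive1_comp (is_derive_expR (f h)) df; exact. Qed.

End RealDerivatives.

Section LaplaceBeltramiExp.
Context {R : realType} {p : nat}.
Implicit Types (x y t v : 'rV[R]_p).
Variable lambda : R.

Lemma derive_line (f : 'rV[R]_p -> R) y v :
  'D_v f y = 'D_1 (fun h : R => f (h *: v + y)) 0.
Proof.
have limE (F G : R -> R) : F = G -> lim (F x @[x --> 0^']) = lim (G x @[x --> 0^']).
  by move=> ->.
apply: limE; apply/funext => h /=.
by rewrite addr0 scale0r add0r [h *: 1]mulr1.
Qed.

(** The extension of e^(lambda t.y) of degree 0, with 1/|y| written as a power of y.y so that the
    power rule applies. *)
Definition expdir t y : R := expR (lambda * (dot t y * (dot y y) `^ (- 2^-1))).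

Lemma expdirE t y : expR (lambda * dot t ((enorm y)^-1 *: y)) = expdir t y.
Proof. by rewrite /expdir /enorm dotZr powRN powR12_sqrt ?dot_ge0// [_ * dot t
  y]mulrC. Qed.

(** Along a coordinate line through y, the product t.y is affine and y.y is quadratic in the
    parameter: the partial derivatives become one-variable ones. *)
Let lin (b c : R) : {poly R} := b *: 'X + c%:P.
Let quad (b c : R) : {poly R} := 'X^2 + (2 * b) *: 'X + c%:P.

Let lin0 b c : (lin b c).[0] = c.
Proof. by rewrite !(hornerD, hornerZ, hornerX, hornerC) mulr0 add0r. Qed.

Let quad0 b c : (quad b c).[0] = c.
Proof. by rewrite !(hornerD, hornerZ, hornerX, hornerC,
  hornerXn) mulr0 expr0n !add0r. Qed.

Let is_derive_lin b c : is_derive (0 : R) 1 (horner (lin b c)) b.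
Proof.
have := is_derive_poly (lin b c) 0; rewrite /lin derivD derivZ derivX derivC.
by rewrite !(hornerD, hornerZ, hornerC) mulr1 addr0.
Qed.

Let is_derive_quad b c : is_derive (0 : R) 1 (horner (quad b c)) (2 * b).
Proof.
have := is_derive_poly (quad b c) 0; rewrite /quad !derivD derivZ derivX derivC derivXn.
by rewrite expr1 !(hornerD, hornerZ, hornerC, hornerMn, hornerX) mulr1 !addr0 add0r.
Qed.

Let dot_line_l t y i h : dot t (h *: delta_mx ord0 i + y) =
  (lin (t ord0 i) (dot t y)).[h].
Proof.
by rewrite dotDr dotZr dot_delta !(hornerD, hornerZ, hornerX, hornerC) mulrC.
Qed.

Let dot_line_q y i h : dot (h *: delta_mx ord0 i + y) (h *: delta_mx ord0 i + y) =
  (quad (y ord0 i) (dot y y)).[h].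
Proof.
rewrite !(dotDr, dotDl, dotZr, dotZl) (dotC (delta_mx ord0 i) y) !dot_delta mxE !eqxx.
by rewrite !(hornerD, hornerZ, hornerX, hornerC, hornerXn) /= mulr1n; ring.
Qed.

Let is_derive_expdir_line t y i : 0 < dot y y ->
  is_derive (0 : R) 1 (fun h : R => expdir t (h *: delta_mx ord0 i + y))
  (expdir t y * (lambda *
    (t ord0 i * (dot y y) `^ (- 2^-1) - dot t y * y ord0 i * (dot y y) `^ (- 2^-1 -
      1)))).
Proof.
move=> y0.
rewrite (_ : (fun _ => _) = fun h : R => expR (lambda * ((lin (t ord0 i) (dot t y)).[h]
    * (quad (y ord0 i) (dot y y)).[h] `^ (- 2^-1)))); last first.
  by apply/funext => h; rewrite /expdir dot_line_l dot_line_q.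
have s0 : 0 < (quad (y ord0 i) (dot y y)).[0] by rewrite quad0.
have := is_derive_exp (is_derive_scale lambda (is_derive_mul
  (is_derive_lin (t ord0 i) (dot t y))
  (is_derive_pow (- 2^-1) s0 (is_derive_quad (y ord0 i) (dot y y))))).
rewrite !lin0 !quad0 => h; apply: is_derive_eq.
by rewrite /expdir; congr (_ * _); field.
Qed.

Lemma derive_expdir t y i : 0 < dot y y ->
  'D_(delta_mx ord0 i) (expdir t) y = expdir t y * (lambda *
    (t ord0 i * (dot y y) `^ (- 2^-1) - dot t y * y ord0 i * (dot y y) `^ (- 2^-1 -
      1))).
Proof. by move=> y0; rewrite derive_line;
  have [_ ->] := is_derive_expdir_line t i y0. Qed.

Lemma derive2_expdir t y i : dot y y = 1 ->
  'D_(delta_mx ord0 i) (fun z => 'D_(delta_mx ord0 i) (expdir t) z) y =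
  expdir t y * (lambda ^+ 2 * (t ord0 i - dot t y * y ord0 i) ^+ 2 +
    lambda * (3 * dot t y * y ord0 i ^+ 2 - 2 * t ord0 i * y ord0 i - dot t y)).
Proof.
move=> y1; have y0 : 0 < dot y y by rewrite y1.
pose G z := expdir t z * (lambda *
    (t ord0 i * (dot z z) `^ (- 2^-1) - dot t z * z ord0 i * (dot z z) `^ (- 2^-1 -
      1))).
(* The formula [G] for the first derivative holds where z.z > 0, a neighbourhood of y, which
   suffices to differentiate again at y. *)
rewrite (@near_eq_derive R _ _ _ G); last first.
  near=> z; apply: derive_expdir; near: z.
  exact: (cvgr_gt (dot y y) (@dot_self_continuous _ _ y)).
rewrite derive_line.
have coordE h : (h *: delta_mx ord0 i + y) ord0 i = (lin 1 (y ord0 i)).[h].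
  by rewrite !mxE !eqxx !(hornerD, hornerZ, hornerX, hornerC) mul1r mulr1.
have s0 : 0 < (quad (y ord0 i) (dot y y)).[0] by rewrite quad0.
have dq := is_derive_lin (t ord0 i) (dot t y).
have dy := is_derive_lin 1 (y ord0 i).
have ds c := is_derive_pow c s0 (is_derive_quad (y ord0 i) (dot y y)).
have := is_derive_mul (is_derive_expdir_line t i y0) (is_derive_scale lambda
  (is_derive_add (is_derive_scale (t ord0 i) (ds (- 2^-1)))
    (is_derive_scale (-1) (is_derive_mul (is_derive_mul dq dy) (ds (- 2^-1 - 1)))))).
rewrite !lin0 !quad0 y1 scale0r add0r powR1 => H.
rewrite (_ : (fun h : R => G _) = (fun h : R => expdir t (h *: delta_mx ord0 i + y) *
  (lambda * (t ord0 i * (quad (y ord0 i) 1).[h] `^ (- 2^-1) + -1 * ((lin (t ord0 i)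
    (dot t y)).[h] * (lin 1 (y ord0 i)).[h] *
   (quad (y ord0 i) 1).[h] `^ (- 2^-1 - 1)))))); last first.
  by apply/funext => h; rewrite /G coordE dot_line_q dot_line_l y1 mulN1r.
by have [_ ->] := H; field.
Unshelve. all: by end_near. Qed.

(** In the sum over i, the squared terms add up to the squared length 1 - (t.x)^2 of the part of t
    tangent to the sphere at x. *)
Lemma laplace_beltrami_exp x t : sphere R p x -> sphere R p t ->
  laplace_beltrami (fun y => expR (lambda * dot t y)) x =
  (lambda ^+ 2 * (1 - dot t x ^+ 2) - lambda * (p%:R - 1) * dot t x) * expR (lambda *
    dot t x).
Proof.
move=> /sphereE x1 /sphereE t1; rewrite /laplace_beltrami /laplacian.
have -> : (fun y => expR (lambda * dot t ((enorm y)^-1 *: y))) = expdir t.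
  by apply/funext => y; exact: expdirE.
rewrite (eq_bigr _ (fun i _ => derive2_expdir t i x1)) -mulr_sumr mulrC.
rewrite /expdir x1 powR1 mulr1; congr (_ * _).
rewrite big_split /= -!mulr_sumr.
have -> : \sum_(i < p) (t ord0 i - dot t x * x ord0 i) ^+ 2 = 1 - dot t x ^+ 2.
  transitivity (dot (t - dot t x *: x) (t - dot t x *: x)).
    by apply: eq_bigr => i _; rewrite !mxE expr2.
  by rewrite !(dotDl, dotDr, dotNl, dotNr, dotZl, dotZr) x1 t1 (dotC x t); ring.
have -> : \sum_(i < p) (3 * dot t x * x ord0 i ^+ 2 - 2 * t ord0 i * x ord0 i - dot t
  x) =
    3 * dot t x * dot x x - 2 * dot t x - p%:R * dot t x.
  transitivity (\sum_(i < p) (3 * dot t x * (x ord0 i * x ord0 i) +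
      (- 2) * (t ord0 i * x ord0 i) + - dot t x)).
    by apply: eq_bigr => i _; ring.
  rewrite !big_split /= -!mulr_sumr sumr_const card_ord -[_ *+ p]mulr_natl.
  by rewrite -/(dot x x) -/(dot t x); ring.
by rewrite x1; ring.
Qed.

End LaplaceBeltramiExp.

(** * Harmonic expansion *)

Lemma cvg_error_bound (R : realType) (b eps : nat -> R) (l c : R) :
  eps n @[n --> \oo] --> (0 : R) -> (forall n, `|l - b n| <= c * eps n) ->
  b n @[n --> \oo] --> l.
Proof.
move=> eps0 hb.
have h0 : c * eps n @[n --> \oo] --> (0 : R).
  by have := cvgM (cvg_cst c) eps0; rewrite mulr0; exact.
have h1 : l - c * eps n @[n --> \oo] --> l.
  by have := cvgB (cvg_cst l) h0; rewrite subr0; exact.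
have h2 : l + c * eps n @[n --> \oo] --> l.
  by have := cvgD (cvg_cst l) h0; rewrite addr0; exact.
apply: (squeeze_cvgr _ h1 h2); apply: nearW => n.
by move: (hb n); rewrite ler_distlC => /andP[h3 h4]; rewrite lerBlDr -lerBlDl; lra.
Qed.

(** * Taylor polynomials of the exponential *)

Section ExponentialTaylor.
Context {R : realType} (lambda : R).
Hypothesis lambda_ge0 : 0 <= lambda.
Implicit Types (N : nat) (u : R).

Definition expP N : {poly R} := \poly_(j < N) (lambda ^+ j / j`!%:R).

Lemma horner_expP N u : (expP N).[u] = series (exp_coeff (lambda * u)) N.
Proof.
rewrite horner_poly /series /= big_mkord; apply: eq_bigr => i _.
by rewrite /exp_coeff /= exprMn mulrAC.
Qed.

Lemma expP_cvg u : (expP N).[u] @[N --> \oo] --> expR (lambda * u).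
Proof.
rewrite (_ : (fun N => _) = series (exp_coeff (lambda * u))); last first.
  by apply/funext => N; exact: horner_expP.
exact: is_cvg_series_exp_coeff.
Qed.

Definition exp_err N : R := expR lambda - (expP N).[1].

Lemma exp_err_cvg0 : exp_err N @[N --> \oo] --> (0 : R).
Proof.
rewrite -[X in _ --> X](subrr (expR lambda)); apply: cvgB; first exact: cvg_cst.
by have := @expP_cvg 1; rewrite mulr1.
Qed.

(** The Taylor coefficients are nonnegative, so on [-1, 1] the tail is largest in absolute value at
    u = 1. *)
Lemma expP_err N u : -1 <= u <= 1 -> `|expR (lambda * u) - (expP N).[u]| <= exp_err N.
Proof.
move=> u1.
have diff M v : (N <= M)%N -> (expP M).[v] - (expP N).[v] =
    \sum_(N <= j < M) (lambda ^+ j / j`!%:R * v ^+ j).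
  move=> NM; rewrite !horner_poly -!(big_mkord xpredT (fun j =>
    lambda ^+ j / j`!%:R * v ^+ j)).
  by rewrite [X in X - _](big_cat_nat (n := N))//= addrAC subrr add0r.
have le M : (N <= M)%N -> `|(expP M).[u] - (expP N).[u]| <= exp_err N.
  move=> NM; apply: (@le_trans _ _ ((expP M).[1] - (expP N).[1])).
    rewrite !diff//; apply: le_trans (ler_norm_sum _ _ _) _; apply: ler_sum => j _.
    rewrite normrM ger0_norm ?divr_ge0 ?exprn_ge0// ler_wpM2l ?divr_ge0 ?exprn_ge0//.
    by rewrite expr1n normrX exprn_ile1// ler_norml.
  rewrite /exp_err lerD2r -[in leRHS](mulr1 lambda).
  have c1 := @expP_cvg 1.
  rewrite -(cvg_lim _ c1)//; apply: nondecreasing_cvgn_le; last by apply/cvg_ex;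
    eexists; exact: c1.
  move=> m n mn; rewrite !horner_poly -!(big_mkord xpredT (fun j =>
    lambda ^+ j / j`!%:R * 1 ^+ j)).
  rewrite [leRHS](big_cat_nat (n := m))//= lerDl sumr_ge0// => j _.
  by rewrite expr1n mulr1 divr_ge0 ?exprn_ge0.
have h : `|(expP M).[u] - (expP N).[u]| @[M --> \oo] --> `|expR (lambda * u) - (expP
  N).[u]|.
  by apply: cvg_norm; apply: cvgB; [exact: expP_cvg|exact: cvg_cst].
rewrite -(cvg_lim _ h)//; apply: limr_le; first by apply/cvg_ex; eexists; exact: h.
by exists N => // M /= NM; exact: le.
Qed.

End ExponentialTaylor.

(** * From polynomials to uniform limits *)

Section UniformLimits.
Context {R : realType} {p : nat}.
Hypothesis p_ge2 : (2 <= p)%N.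
Variable nu : probability (borelRV R p) R.
Hypothesis hnu : uniform_on_sphere nu.
Implicit Types (x y t : 'rV[R]_p).
Let a : R := (p%:R - 2) / 2.
Let a_ge0 : 0 <= a := @gegindex_ge0 R p p_ge2.
Local Notation smean := (smean nu).

Lemma smean_norm_le (g : 'rV[R]_p -> R) M : continuous g ->
  (forall t, sphere R p t -> `|g t| <= M) -> `|smean g| <= M.
Proof.
move=> cg gM; have cM c : continuous (fun _ : 'rV[R]_p => c : R) by move=> ?;
  exact: cst_continuous.
rewrite ler_norml -{1}(smean_cst hnu (- M)) -{2}(smean_cst hnu M).
by apply/andP; split; apply: smean_le => // t /gM; rewrite ler_norml => /andP[].
Qed.

Lemma smeanB (g h : 'rV[R]_p -> R) : continuous g -> continuous h ->
  smean g - smean h = smean (fun t => g t - h t).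
Proof.
move=> cg ch; rewrite -mulN1r -(smeanZ nu)// -(smeanD nu)//.
  by apply: eq_smean => t _; rewrite mulN1r.
by apply: mulr_fun_continuous => //; exact: cst_continuous.
Qed.

Section Limit.
Variables (f : R -> R) (fN : nat -> {poly R}) (eps : nat -> R).
Hypothesis cf : continuous f.
Hypothesis eps0 : eps N @[N --> \oo] --> (0 : R).
Hypothesis hf : forall N u, -1 <= u <= 1 -> `|f u - (fN N).[u]| <= eps N.

Let cD N : continuous (fun u => f u - (fN N).[u]).
Proof. by move=> u; apply: cvgB; [exact: cf|exact: continuous_horner]. Qed.

Lemma gegL_cvg_smean x : sphere R p x ->
  gegL a (fN N) @[N --> \oo] --> smean (fun t => f (dot x t)).
Proof.
move=> Sx; apply: (cvg_error_bound (c := 1) eps0) => N; rewrite mul1r.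
rewrite -(smean_horner p_ge2 hnu Sx (fN N) Sx) smeanB; last 2 first.
- exact: zonal_continuous.
- exact: horner_zonal_continuous.
apply: smean_norm_le; first exact: (zonal_continuous (phi := fun u =>
  f u - (fN N).[u])).
by move=> t St; apply: hf; exact: dot_sphere_le1.
Qed.

Lemma gegL_cvg_gegI : gegL a (fN N) @[N --> \oo] --> gegI a f / gegI1 a.
Proof.
have I0 : 0 < gegI1 a := gegI1_gt0 a_ge0.
apply: (cvg_error_bound (c := 1) eps0) => N; rewrite mul1r.
have -> : gegL a (fN N) = gegI a (horner (fN N)) / gegI1 a.
  by rewrite gegI_horner// mulrAC divff ?mul1r// gt_eqF.
rewrite -mulrBl normrM [`|_^-1|]gtr0_norm ?invr_gt0// ler_pdivrMr//.
rewrite -mulN1r -gegIZ//; last exact: continuous_horner.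
rewrite -gegID//; last first.
  by apply: mulr_fun_continuous; [exact: cst_continuous|exact: continuous_horner].
apply: gegI_norm_le => //.
  by move=> u; under eq_fun do rewrite mulN1r; exact: cD.
by move=> u u1; rewrite mulN1r; exact: hf.
Qed.

End Limit.

Section Product.
Variables (f : R -> R) (fN : nat -> {poly R}) (eps : nat -> R).
Hypothesis cf : continuous f.
Hypothesis eps0 : eps N @[N --> \oo] --> (0 : R).
Hypothesis hf : forall N u, -1 <= u <= 1 -> `|f u - (fN N).[u]| <= eps N.
Variable g : {poly R}.

Lemma uniform_limit_mul : exists eps' : nat -> R, eps' N @[N --> \oo] --> (0 : R) /\
  forall N u, -1 <= u <= 1 -> `|g.[u] * f u - (g * fN N).[u]| <= eps' N.
Proof.
have [M M0 hM] := continuous_bound_itv (@continuous_horner _ g).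
exists (fun N => M * eps N); split.
  by have := cvgM (cvg_cst M) eps0; rewrite mulr0; exact.
by move=> N u u1; rewrite hornerM -mulrBr normrM ler_pM//; [exact: hM|exact: hf].
Qed.

End Product.

(** Uniform limit of [funk_hecke]. The scalar is kept as a mean with y = x, as [gegL] accepts only
    polynomials. *)
Lemma funk_hecke_continuous (f : R -> R) (fN : nat -> {poly R}) (eps : nat -> R) k x y :
  continuous f -> eps N @[N --> \oo] --> (0 : R) ->
  (forall N u, -1 <= u <= 1 -> `|f u - (fN N).[u]| <= eps N) ->
  sphere R p x -> sphere R p y ->
  smean (fun t => (zgeg a k).[dot x t] * f (dot y t)) =
  smean (fun t => (zgeg a k).[dot x t] * f (dot x t)) * (zgeg a k).[dot x y].
Proof.
move=> cf eps0 hf Sx Sy.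
have [eps' [eps'0 hf']] := uniform_limit_mul eps0 hf (zgeg a k).
have cg : continuous (fun u => (zgeg a k).[u] * f u).
  by apply: mulr_fun_continuous => //; exact: continuous_horner.
have h1 := gegL_cvg_smean cg eps'0 hf' Sx.
have h2 : gegL a (zgeg a k * fN N) * (zgeg a k).[dot x y] @[N --> \oo] -->
    smean (fun t => (zgeg a k).[dot x t] * f (dot x t)) * (zgeg a k).[dot x y].
  by apply: cvgM; [exact: h1|exact: cvg_cst].
rewrite -(cvg_lim _ h2)//; apply/esym/cvg_lim => //.
have [M M0 hM] := continuous_bound_itv (@continuous_horner _ (zgeg a k)).
apply: (cvg_error_bound (c := M) eps0) => N /=.
rewrite -(funk_hecke p_ge2 hnu Sx (fN N) k Sx Sy) smeanB; last 2 first.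
- by apply: mulr_fun_continuous;
  [exact: horner_zonal_continuous|exact: zonal_continuous].
- by apply: mulr_fun_continuous; exact: horner_zonal_continuous.
apply: smean_norm_le => [|t St].
  apply: subr_fun_continuous.
    by apply: mulr_fun_continuous;
      [exact: horner_zonal_continuous|exact: zonal_continuous].
  by apply: mulr_fun_continuous; exact: horner_zonal_continuous.
rewrite -mulrBr normrM ler_pM//; first by apply: hM; exact: dot_sphere_le1.
by apply: hf; exact: dot_sphere_le1.
Qed.

End UniformLimits.

(** * Parseval's identity for the Laplacian of the exponential *)

Section LaplacianExpansion.
Context {R : realType} {p : nat}.
Hypothesis p_ge2 : (2 <= p)%N.
Variable nu : probability (borelRV R p) R.
Hypothesis hnu : uniform_on_sphere nu.
Variable lambda : R.
Hypothesis lambda_ge0 : 0 <= lambda.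
Implicit Types (x y t : 'rV[R]_p) (k l N K : nat).
Let a : R := (p%:R - 2) / 2.
Let a_ge0 : 0 <= a := @gegindex_ge0 R p p_ge2.
Local Notation smean := (smean nu).
Local Notation Z := (zgeg a).

(** In contrast to [m_coef], the polynomial is normalized at 1, the weight has mass 1, and there is
    no division by the squared norm. *)
Definition expcoef k : R := gegI a (fun u => (Z k).[u] * expR (lambda * u)) / gegI1 a.

Definition lap_eigenvalue k : R := k%:R * (k%:R + 2 * a).

Definition lapexp u : R :=
  (lambda ^+ 2 * (1 - u ^+ 2) - lambda * (p%:R - 1) * u) * expR (lambda * u).

Lemma exp_scale_continuous : continuous (fun u : R => expR (lambda * u)).
Proof.
move=> u; have h : {for u, continuous ( *%R lambda)} by exact: mulrl_continuous.
by have := continuous_cvg _ (@continuous_expR R (lambda * u)) h; exact.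
Qed.

Lemma lapexp_continuous : continuous lapexp.
Proof.
apply: mulr_fun_continuous; last exact: exp_scale_continuous.
rewrite (_ : (fun s => _) =
  horner ((lambda ^+ 2)%:P * (1 - 'X^2) - (lambda * (p%:R - 1))%:P * 'X)).
  exact: continuous_horner.
by apply/funext => u; rewrite -[X in X - 'X^2]polyC1 !(hornerD, hornerN, hornerM,
  hornerC, hornerX, hornerXn).
Qed.

Let exp_err_uniform := @expP_err R lambda lambda_ge0.

Lemma gegL_expcoef_cvg k : gegL a (Z k * expP lambda N) @[N --> \oo] --> expcoef k.
Proof.
have [eps [eps0 h]] := uniform_limit_mul (@exp_err_cvg0 R lambda) exp_err_uniform (Z k).
apply: (gegL_cvg_gegI p_ge2 _ eps0 h).
by apply: mulr_fun_continuous; [exact: continuous_horner|exact: exp_scale_continuous].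
Qed.

(** The shift by 2 leaves [expP lambda N] after two derivatives. *)
Let lapP N : {poly R} := gegD a (expP lambda N.+2).

Lemma deriv_expP N : deriv (expP lambda N.+1) = lambda *: expP lambda N.
Proof.
apply/polyP => i; rewrite coef_deriv coefZ !coef_poly ltnS.
case: ifP => _; last by rewrite mul0rn mulr0.
rewrite -[_ *+ i.+1]mulr_natl factS natrM exprS.
have f0 : i`!%:R != 0 :> R by rewrite pnatr_eq0 -lt0n fact_gt0.
have i0 : i.+1%:R != 0 :> R by rewrite pnatr_eq0.
by move: f0 i0; move: (i`!%:R) (i.+1%:R) => A B A0 B0; field; rewrite A0 B0.
Qed.

Let epsF N := lambda ^+ 2 * exp_err lambda N + lambda * (p%:R - 1) * exp_err lambda
  N.+1.

Let epsF_cvg0 : epsF N @[N --> \oo] --> (0 : R).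
Proof.
have e0 := @exp_err_cvg0 R lambda.
have e1 : exp_err lambda N.+1 @[N --> \oo] --> (0 : R).
  by rewrite (@cvg_shiftS R (exp_err lambda)).
have h : epsF N @[N --> \oo] --> lambda ^+ 2 * 0 + lambda * (p%:R - 1) * 0.
  by apply: cvgD; apply: cvgM; [exact: cvg_cst|exact: e0|exact: cvg_cst|exact: e1].
by move: h; rewrite !mulr0 addr0.
Qed.

(** Derivatives of a Taylor polynomial of e^(lambda u) are multiples of shorter ones, so the error
    is that of two truncations, weighted by 1 - u^2 and u, both bounded by 1 in absolute value. *)
Let lapP_err N u : -1 <= u <= 1 -> `|lapexp u - (lapP N).[u]| <= epsF N.
Proof.
move=> u1; have nu1 : `|u| <= 1 by rewrite ler_norml.
have p1 : 0 <= p%:R - 1 :> R by rewrite subr_ge0 ler1n (leq_trans _ p_ge2).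
have -> : lapexp u - (lapP N).[u] =
    lambda ^+ 2 * ((1 - u ^+ 2) * (expR (lambda * u) - (expP lambda N).[u])) -
    lambda * (p%:R - 1) * (u * (expR (lambda * u) - (expP lambda N.+1).[u])).
  rewrite /lapP /gegD !deriv_expP derivZ deriv_expP -[X in X - 'X^2]polyC1.
  rewrite !(hornerD, hornerN, hornerM, hornerC, hornerX, hornerXn, hornerZ) /lapexp.
  have -> : 2 * a + 1 = p%:R - 1 by rewrite /a; field.
  by ring.
have q0 : 0 <= 1 - u ^+ 2 <= 1.
  rewrite gerBl sqr_ge0 andbT subr_ge0 -(real_normK (num_real u)).
  by rewrite exprn_ile1.
have lp0 : 0 <= lambda * (p%:R - 1) by rewrite mulr_ge0.
apply: le_trans (ler_normB _ _) _; rewrite /epsF; apply: lerD.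
  rewrite normrM (ger0_norm (exprn_ge0 2 lambda_ge0)) ler_wpM2l ?exprn_ge0// normrM.
  have /andP[q1 q2] := q0; rewrite (ger0_norm q1).
  by rewrite (le_trans _ (exp_err_uniform N u1))// ler_piMl.
rewrite normrM (ger0_norm lp0) ler_wpM2l// normrM.
by rewrite (le_trans _ (exp_err_uniform N.+1 u1))// ler_piMl.
Qed.

Let size_lapP N : (size (lapP N) <= N.+2)%N.
Proof.
apply/leq_sizeP => j Nj; rewrite coef_gegD !coef_poly.
have -> : (j < N.+2)%N = false by apply/negbTE; rewrite -leqNgt.
have -> : (j.+2 < N.+2)%N = false by apply/negbTE;
  rewrite -leqNgt (leq_trans Nj)// ltnW.
by rewrite !mulr0 subrr.
Qed.

(** For the approximating polynomials D is moved onto Z_k by self-adjointness, which produces the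
    eigenvalue; the limit then gives the claim. *)
Lemma smean_zgeg_lapexp_diag k x : sphere R p x ->
  smean (fun t => (Z k).[dot x t] * lapexp (dot x t)) = - lap_eigenvalue k * expcoef k.
Proof.
move=> Sx; have [eps [eps0 h]] := uniform_limit_mul epsF_cvg0 lapP_err (Z k).
have cg : continuous (fun u => (Z k).[u] * lapexp u).
  by apply: mulr_fun_continuous; [exact: continuous_horner|exact: lapexp_continuous].
have h1 := gegL_cvg_smean p_ge2 hnu cg eps0 h Sx.
rewrite -(cvg_lim _ h1)//; apply/cvg_lim => //.
rewrite (_ : (fun N => _) = (fun N =>
  - lap_eigenvalue k * gegL a (Z k * expP lambda N.+2))); last first.
  apply/funext => N; rewrite /lapP -gegL_selfadj// zgeg_ode//.
  by rewrite -gegLCM polyCN mulrA.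
apply: cvgM; first exact: cvg_cst.
have := @gegL_expcoef_cvg k.
by rewrite -(@cvg_shiftS R (fun N => gegL a (Z k * expP lambda N)))
  -(@cvg_shiftS R (fun N => gegL a (Z k * expP lambda N.+1))); exact.
Qed.

Lemma smean_zgeg_lapexp k x y : sphere R p x -> sphere R p y ->
  smean (fun t => (Z k).[dot x t] * lapexp (dot y t)) =
    - lap_eigenvalue k * expcoef k * (Z k).[dot x y].
Proof.
move=> Sx Sy; rewrite (funk_hecke_continuous p_ge2 hnu k lapexp_continuous epsF_cvg0
  lapP_err Sx Sy).
by rewrite smean_zgeg_lapexp_diag.
Qed.

(** The Fourier coefficients of F: [S K] is its projection onto polynomials of degree below K, and
    [delta K] the remainder. *)
Let c k := - lap_eigenvalue k * expcoef k / zgeg_sqnorm a k.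
Let S K : {poly R} := \sum_(k < K) c k *: Z k.
Let delta K u := lapexp u - (S K).[u].

Let delta_continuous K : continuous (delta K).
Proof. by apply: subr_fun_continuous;
  [exact: lapexp_continuous|exact: continuous_horner]. Qed.

Let h_neq0 k : zgeg_sqnorm a k != 0.
Proof. by rewrite gt_eqF// zgeg_sqnorm_gt0. Qed.

Let gegL_S K l : (l < K)%N -> gegL a (Z l * S K) = - lap_eigenvalue l * expcoef l.
Proof.
move=> lK; rewrite /S mulr_sumr raddf_sum /= (bigD1 (Ordinal lK))//= big1 => [|i il].
  by rewrite -scalerAr gegLZ -/(zgeg_sqnorm a l) addr0 /c divfK.
rewrite -scalerAr gegLZ zgeg_orth ?mulr0//.
by apply: contraNneq il => il; apply/eqP/val_inj.
Qed.

Let smean_zgeg_delta K l x y : (l < K)%N -> sphere R p x -> sphere R p y ->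
  smean (fun t => (Z l).[dot x t] * delta K (dot y t)) = 0.
Proof.
move=> lK Sx Sy.
transitivity (smean (fun t => (Z l).[dot x t] * lapexp (dot y t)) -
   smean (fun t => (Z l).[dot x t] * (S K).[dot y t])).
  rewrite smeanB; last 2 first.
  - by apply: mulr_fun_continuous;
    [exact: horner_zonal_continuous|apply: zonal_continuous; exact: lapexp_continuous].
  - by apply: mulr_fun_continuous; exact: horner_zonal_continuous.
  by apply: eq_smean => t _; rewrite mulrBr.
by rewrite smean_zgeg_lapexp// (funk_hecke p_ge2 hnu Sx)// gegL_S// subrr.
Qed.

(** Z_n has degree exactly n, so subtracting a multiple of it lowers the size of g; each Z_n removed
    is orthogonal to the remainder. *)
Let smean_poly_delta K (g : {poly R}) x : (size g <= K)%N -> sphere R p x ->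
  smean (fun t => g.[dot x t] * delta K (dot x t)) = 0.
Proof.
move=> sg Sx.
have cdelta : continuous (fun t => delta K (dot x t)).
  by apply: zonal_continuous; exact: delta_continuous.
have [n nK gn] : exists2 n, (n <= K)%N & (size g <= n)%N by exists K.
elim: n g gn nK {sg} => [|n IH] g gn nK.
  move: gn; rewrite leqn0 size_poly_eq0 => /eqP ->.
  by rewrite -[RHS](smean_cst hnu 0); apply: eq_smean => t _; rewrite horner0 mul0r.
pose b := g`_n / (Z n)`_n; pose g1 := g - b *: Z n.
have Zn0 : (Z n)`_n != 0 by rewrite gt_eqF// coef_zgeg_gt0.
have g1n : (size g1 <= n)%N.
  apply/leq_sizeP => j; rewrite leq_eqVlt => /predU1P[<-|nj].
    by rewrite coefB coefZ /b divfK ?subrr.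
  by rewrite coefB coefZ !nth_default ?mulr0 ?subrr// ?size_zgeg// (leq_trans gn).
have -> : g = g1 + b *: Z n by rewrite subrK.
transitivity (smean (fun t => g1.[dot x t] * delta K (dot x t)) +
   b * smean (fun t => (Z n).[dot x t] * delta K (dot x t))).
  have c1 (q : {poly R}) : continuous (fun t => q.[dot x t] * delta K (dot x t)).
    by apply: mulr_fun_continuous => //; exact: horner_zonal_continuous.
  rewrite -(smeanZ nu)// -(smeanD nu)//; last by apply: mulr_fun_continuous => //;
    exact: cst_continuous.
  by apply: eq_smean => t _; rewrite hornerD hornerZ mulrDl mulrA.
by rewrite smean_zgeg_delta// mulr0 addr0 IH// ltnW.
Qed.

(* F(x) F(y) = delta(x) delta(y) + S(x) delta(y) + F(x) S(y), where the middle term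
   has mean 0. *)
Lemma smean_lapexp_sum K x y : sphere R p x -> sphere R p y ->
  smean (fun t => lapexp (dot x t) * lapexp (dot y t)) -
  \sum_(k < K) (lap_eigenvalue k * expcoef k) ^+ 2 / zgeg_sqnorm a k * (Z k).[dot x y] =
  smean (fun t => delta K (dot x t) * delta K (dot y t)).
Proof.
move=> Sx Sy.
have cF z : continuous (fun t => lapexp (dot z t)) by apply: zonal_continuous;
  exact: lapexp_continuous.
have cd z : continuous (fun t => delta K (dot z t)) by apply: zonal_continuous;
  exact: delta_continuous.
have cS z : continuous (fun t => (S K).[dot z t]) by exact: horner_zonal_continuous.
have cZ k z : continuous (fun t => (Z k).[dot z t]) by exact: horner_zonal_continuous.
have h1 : smean (fun t => (S K).[dot x t] * delta K (dot y t)) = 0.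
  transitivity (\sum_(k < K) c k * smean (fun t =>
    (Z k).[dot x t] * delta K (dot y t))).
    rewrite (eq_bigr (fun k : 'I_K => smean (fun t =>
      c k * ((Z k).[dot x t] * delta K (dot y t))))).
      rewrite -(smean_sum hnu) => [|k].
        apply: eq_smean => t _; rewrite /S horner_sum mulr_suml; apply: eq_bigr => k _.
        by rewrite hornerZ mulrA.
      by apply: mulr_fun_continuous; [exact: cst_continuous|exact: mulr_fun_continuous].
    by move=> k _; rewrite (smeanZ nu)//; exact: mulr_fun_continuous.
  by apply: big1 => k _; rewrite smean_zgeg_delta ?mulr0.
have h2 : smean (fun t => lapexp (dot x t) * (S K).[dot y t]) =
    \sum_(k < K) (lap_eigenvalue k * expcoef k) ^+ 2 / zgeg_sqnorm a k * (Z k).[dot x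
      y].
  transitivity (\sum_(k < K) c k * smean (fun t => (Z k).[dot y t] * lapexp (dot x t))).
    rewrite (eq_bigr (fun k : 'I_K => smean (fun t =>
      c k * ((Z k).[dot y t] * lapexp (dot x t))))).
      rewrite -(smean_sum hnu) => [|k].
        apply: eq_smean => t _; rewrite /S horner_sum mulr_sumr; apply: eq_bigr => k _.
        by rewrite hornerZ; ring.
      by apply: mulr_fun_continuous; [exact: cst_continuous|exact: mulr_fun_continuous].
    by move=> k _; rewrite (smeanZ nu)//; exact: mulr_fun_continuous.
  apply: eq_bigr => k _; rewrite smean_zgeg_lapexp// dotC /c.
  by have := h_neq0 k => hk; field.
rewrite -h2 -[X in _ - X]addr0 -{1}h1 -(smeanD nu); last 2 first.
- exact: mulr_fun_continuous.
- exact: mulr_fun_continuous.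
rewrite smeanB; last 2 first.
- exact: mulr_fun_continuous.
- by apply: addr_fun_continuous; exact: mulr_fun_continuous.
by apply: eq_smean => t _; rewrite /delta; ring.
Qed.

(* S is the orthogonal projection of F, so it is at least as close to F as [lapP N]. *)
Let smean_delta2_le N x : sphere R p x ->
  smean (fun t => delta N.+2 (dot x t) ^+ 2) <= epsF N ^+ 2.
Proof.
move=> Sx; pose g := S N.+2 - lapP N.
have cd : continuous (fun t => delta N.+2 (dot x t)) by apply: zonal_continuous;
  exact: delta_continuous.
have cg : continuous (fun t => g.[dot x t]) by exact: horner_zonal_continuous.
have cd2 : continuous (fun t => delta N.+2 (dot x t) ^+ 2).
  by under eq_fun do rewrite expr2; exact: mulr_fun_continuous.
have cg2 : continuous (fun t => g.[dot x t] ^+ 2).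
  by under eq_fun do rewrite expr2; exact: mulr_fun_continuous.
have cgd : continuous (fun t =>
  g.[dot x t] * delta N.+2 (dot x t)) by exact: mulr_fun_continuous.
have sg : (size g <= N.+2)%N.
  apply/leq_sizeP => j Nj; rewrite /g coefB (nth_default _ (leq_trans (size_lapP N)
    Nj)) subr0.
  rewrite /S coef_sum big1// => i _; rewrite coefZ nth_default ?mulr0//.
  by rewrite size_zgeg// (leq_trans _ Nj).
have cF : continuous (fun t => lapexp (dot x t) - (lapP N).[dot x t]).
  by apply: subr_fun_continuous; [apply: zonal_continuous;
    exact: lapexp_continuous|exact: horner_zonal_continuous].
(* Pythagoras: F - [lapP N] = delta + g, where g has low degree and is therefore orthogonal to
   delta. *)
have e : smean (fun t => (lapexp (dot x t) - (lapP N).[dot x t]) ^+ 2) =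
    smean (fun t => delta N.+2 (dot x t) ^+ 2) + smean (fun t => g.[dot x t] ^+ 2).
  rewrite -[RHS]addr0 -(mulr0 2) -(smean_poly_delta sg Sx) -(smeanZ nu)// -!(smeanD
    nu)//.
  - by apply: eq_smean => t _; rewrite /delta /g hornerD hornerN; ring.
  - exact: addr_fun_continuous.
  - by apply: mulr_fun_continuous => //; exact: cst_continuous.
apply: (@le_trans _ _ (smean (fun t => (lapexp (dot x t) - (lapP N).[dot x t]) ^+ 2))).
  by rewrite e lerDl; apply: Rintegral_ge0 => t _; exact: sqr_ge0.
rewrite -[leRHS](smean_cst hnu); apply: smean_le => //.
- by under eq_fun do rewrite expr2; exact: mulr_fun_continuous.
- by move=> ?; exact: cst_continuous.
move=> t St; have := lapP_err N (dot_sphere_le1 Sx St) => h.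
by rewrite -(real_normK (num_real (_ - _))) ler_sqr ?nnegrE// (le_trans _ h).
Qed.

Lemma smean_lapexp_cvg x y : sphere R p x -> sphere R p y ->
  \sum_(k < K) (lap_eigenvalue k * expcoef k) ^+ 2 / zgeg_sqnorm a k * (Z k).[dot x
    y] @[K --> \oo] -->
  smean (fun t => lapexp (dot x t) * lapexp (dot y t)).
Proof.
move=> Sx Sy; set u := fun K => _.
rewrite -(@cvg_shiftS R u) -(@cvg_shiftS R (fun K => u K.+1)).
have eps20 : epsF N ^+ 2 @[N --> \oo] --> (0 : R).
  by have := cvgM epsF_cvg0 epsF_cvg0; rewrite mulr0; exact.
apply: (cvg_error_bound (c := 1) eps20) => N; rewrite mul1r /u smean_lapexp_sum//.
have cd z : continuous (fun t => delta N.+2 (dot z t)) by apply: zonal_continuous;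
  exact: delta_continuous.
have cd2 z : continuous (fun t => delta N.+2 (dot z t) ^+ 2).
  by under eq_fun do rewrite expr2; exact: mulr_fun_continuous.
(* The cases s = 1 and s = -1 together bound the absolute value. From 2 s a b <= a^2 + b^2, the
   remainder at the pair (x, y) is controlled by the two diagonal ones. *)
have bound s : s ^+ 2 = 1 -> s * smean (fun t =>
  delta N.+2 (dot x t) * delta N.+2 (dot y t)) <= epsF N ^+ 2.
  move=> s1; rewrite -(smeanZ nu); last exact: mulr_fun_continuous.
  apply: (@le_trans _ _ (smean (fun t =>
    2^-1 * (delta N.+2 (dot x t) ^+ 2 + delta N.+2 (dot y t) ^+ 2)))).
    apply: smean_le.
    - by apply: mulr_fun_continuous; [exact: cst_continuous|exact: mulr_fun_continuous].
    - by apply: mulr_fun_continuous; [exact: cst_continuous|exact: addr_fun_continuous].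
    move=> t _; have := sqr_ge0 (delta N.+2 (dot x t) - s * delta N.+2 (dot y t)).
    by rewrite sqrrB exprMn s1 mul1r mulrCA; lra.
  rewrite (smeanZ nu); last exact: addr_fun_continuous.
  rewrite (smeanD nu)//.
  have := smean_delta2_le N Sx; have := smean_delta2_le N Sy; lra.
rewrite ler_norml lerNl -mulN1r bound ?sqrrN ?expr1n//=.
by rewrite -[leLHS]mul1r bound// expr1n.
Qed.

End LaplacianExpansion.

(** * Bessel coefficients *)

Section BesselCoefficients.
Context {R : realType} (a : R).
Hypothesis a_ge0 : 0 <= a.
Implicit Types (j k N : nat).
Local Notation Z := (zgeg a).

Let Gneq0 x : 0 < x -> Gamma x != 0 :> R.
Proof. by move=> x0; rewrite gt_eqF// Gamma_gt0. Qed.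

Lemma gegL_diag_Gamma k :
  gegL a ('X^k * Z k) * (Gamma (k%:R + a + 1) * 2 ^+ k) = k`!%:R * Gamma (a + 1).
Proof.
elim: k => [|k IH]; first by rewrite mulr1 gegLXn /= mulr0n add0r fact0; ring.
have ka : 0 < k.+1%:R + a :> R by rewrite ltr_wpDr// ltr0n.
rewrite gegL_diagS// (GammaS ka) factS natrM -[RHS]mulrA -IH exprS.
rewrite (_ : k.+1%:R + a = k%:R + a + 1); last by rewrite -natr1; ring.
by field; move: ka; rewrite -natr1 => /lt0r_neq0; rewrite [_ + 1 + _]addrAC => ->.
Qed.

(** At n = k + 2j the recurrence has the factor 2 (j + 1) times 2 (j + 1 + a + k); these accumulate
    to 4^j j! and a quotient of Gamma values. *)
Lemma gegL_even_Gamma k j :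
  gegL a ('X^(k + j.*2) * Z k) * (4 ^+ j * j`!%:R * 2 ^+ k * Gamma (j%:R + (a + k%:R)
    + 1)) =
  (k + j.*2)`!%:R * Gamma (a + 1).
Proof.
elim: j => [|j IH].
  rewrite addn0 mulr0n add0r -gegL_diag_Gamma (addrC a) fact0; ring.
have h := gegL_Xn_zgeg_rec a_ge0 (k + j.*2) k.
rewrite doubleS !addnS !factS !natrM.
have jk : 0 < j.+1%:R + (a + k%:R) :> R by rewrite ltr_pwDl ?ltr0n ?addr_ge0.
rewrite (GammaS jk) (_ : j.+1%:R + (a + k%:R) = j%:R + (a + k%:R) + 1);
  last by rewrite -natr1; ring.
move: h; rewrite (_ : (k + j.*2).+2%:R - k%:R = 2 * (j%:R + 1) :> R); last first.
  by rewrite -!natr1 natrD -mul2n natrM; ring.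
rewrite (_ : (k + j.*2).+2%:R + k%:R + 2 * a = 2 * (j%:R + (a + k%:R) + 1) :> R);
  last first.
  by rewrite -!natr1 natrD -mul2n natrM; ring.
move=> h.
transitivity ((k + j.*2).+2%:R * (k + j.*2).+1%:R * ((k + j.*2)`!%:R * Gamma (a +
  1))); last by ring.
rewrite -IH.
rewrite [RHS](_ : _ = (k + j.*2).+2%:R * (k + j.*2).+1%:R * gegL a ('X^(k + j.*2) * Z
  k) *
  (4 ^+ j * j`!%:R * 2 ^+ k * Gamma (j%:R + (a + k%:R) + 1))); last by ring.
by rewrite -h [4 ^+ _]exprS -[j.+1%:R]natr1; ring.
Qed.

Variable lambda : R.
Hypothesis lambda_gt0 : 0 < lambda.

(** [b k j] is the j-th term of the Bessel series of order a + k, and [C] the factor common to all k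
    and j. *)
Let C : R := Gamma (a + 1) * (2 / lambda) `^ a.
Let b k j : R := (lambda / 2) `^ (2 * j%:R + (a + k%:R)) / (j`!%:R * Gamma (j%:R + (a
  + k%:R) + 1)).

Let expPS N : expP lambda N.+1 = expP lambda N + (lambda ^+ N / N`!%:R) *: 'X^N.
Proof. by rewrite /expP !poly_def big_ord_recr. Qed.

Let bE k j : C * b k j = lambda ^+ (k + j.*2) / (k + j.*2)`!%:R * gegL a ('X^(k +
  j.*2) * Z k).
Proof.
have G0 : Gamma (j%:R + (a + k%:R) + 1) != 0 :> R by rewrite Gneq0// ltr_pwDr ?addr_ge0.
have l20 : 0 < lambda / 2 by rewrite divr_gt0.
have e1 : (lambda / 2) `^ (2 * j%:R + (a + k%:R)) =
  (lambda / 2) `^ a * (lambda / 2) ^+ (k + j.*2).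
  rewrite -powR_mulrn ?(ltW l20)// -powRD; last by apply/implyP => _; rewrite gt_eqF.
  by congr (_ `^ _); rewrite natrD -mul2n natrM; ring.
have e2 : (2 / lambda) `^ a * (lambda / 2) `^ a = 1.
  rewrite -powRM ?divr_ge0 ?(ltW lambda_gt0)//.
  by rewrite mulrA divfK ?gt_eqF// divff// powR1.
rewrite /C /b e1 (_ : _ * _ = Gamma (a + 1) * ((2 / lambda) `^ a * (lambda / 2) `^ a) *
  ((lambda / 2) ^+ (k + j.*2) / (j`!%:R * Gamma (j%:R + (a + k%:R) + 1))));
    last by ring.
rewrite e2 mulr1.
have h := gegL_even_Gamma k j.
have f1 : (k + j.*2)`!%:R != 0 :> R by rewrite pnatr_eq0 -lt0n fact_gt0.
have f2 : j`!%:R != 0 :> R by rewrite pnatr_eq0 -lt0n fact_gt0.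
have t2 : 2 ^+ k != 0 :> R by rewrite expf_neq0.
have t4 : 4 ^+ j != 0 :> R by rewrite expf_neq0.
have -> : Gamma (a + 1) = gegL a ('X^(k + j.*2) * Z k) *
   (4 ^+ j * j`!%:R * 2 ^+ k * Gamma (j%:R + (a + k%:R) + 1)) / (k + j.*2)`!%:R.
  by rewrite h mulrAC divff ?mul1r.
have -> : (lambda / 2) ^+ (k + j.*2) = lambda ^+ (k + j.*2) / (2 ^+ k * 4 ^+ j).
  by rewrite expr_div_n; congr (_ / _); rewrite exprD -mul2n exprM -[2 ^+ 2]natrX.
by field; rewrite f1 f2 t2 t4 G0.
Qed.

(** Degrees below k vanish by orthogonality and those of the wrong parity by [gegL_Xn_zgeg_odd]; a
    Taylor polynomial cut at k + 2J thus retains exactly J Bessel terms. *)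
Let gegL_expP k J : gegL a (Z k * expP lambda (k + J.*2)) = C * \sum_(0 <= j < J) b k j.
Proof.
elim: J => [|J IH].
  rewrite big_nil mulr0 mulrC gegL_zgeg//;
    last by rewrite addn0 (leq_trans (size_poly _ _)).
  by rewrite nth_default ?mul0r// addn0 size_poly.
rewrite doubleS !addnS 2!expPS !mulrDr !raddfD /= IH big_nat_recr//= mulrDr bE.
rewrite -!scalerAr !gegLZ ![Z k * _]mulrC -[(k + J.*2).+1]addnS gegL_Xn_zgeg_odd//.
by rewrite mulr0 addr0.
Qed.

Lemma expcoef_series k (l : R) : gegL a (Z k * expP lambda N) @[N --> \oo] --> l ->
  l = Gamma (a + 1) * (2 / lambda) `^ a * besselI (a + k%:R) lambda.
Proof.
move=> hl; rewrite -/C.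
have C0 : C != 0.
  by rewrite mulf_neq0 ?Gneq0 ?ltr_wpDl// gt_eqF// powR_gt0// divr_gt0.
have h2 : gegL a (Z k * expP lambda (k + J.*2)) @[J --> \oo] --> l.
  apply: (cvg_comp (fun J => (k + J.*2)%N) (fun N =>
    gegL a (Z k * expP lambda N)) _ hl).
  move=> A [N _ NA]; exists N => // n /= Nn; apply: NA => /=.
  by rewrite (leq_trans Nn)// (leq_trans _ (leq_addl _ _))// -addnn leq_addr.
have h3 : \sum_(0 <= j < J) b k j @[J --> \oo] --> C^-1 * l.
  rewrite (_ : (fun J => _) = (fun J => C^-1 * gegL a (Z k * expP lambda (k + J.*2)))).
    by apply: cvgM; [exact: cvg_cst|exact: h2].
  by apply/funext => J; rewrite gegL_expP mulKf.
by rewrite /besselI (cvg_lim _ h3)// mulVKf.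
Qed.

End BesselCoefficients.

(** * Standard normalization and Chebyshev polynomials *)

Section StandardNormalization.
Context {R : realType}.
Implicit Types (a u : R) (k : nat).

(** At a = 0 the factor i = 0 vanishes, so the Chebyshev case is treated apart. *)
Definition gegenbauer_at1 a k : R := \prod_(i < k) ((2 * a + i%:R) / i.+1%:R).

Lemma gegenbauer_at1S a k : gegenbauer_at1 a k.+1 =
  gegenbauer_at1 a k * ((2 * a + k%:R) / k.+1%:R).
Proof. exact: big_ord_recr. Qed.

Lemma gegenbauer_zgegE a k : 0 < a -> gegenbauer a k = gegenbauer_at1 a k *: zgeg a k.
Proof.
move=> a0; suff: gegenbauer a k = gegenbauer_at1 a k *: zgeg a k /\
    gegenbauer a k.+1 = gegenbauer_at1 a k.+1 *: zgeg a k.+1 by case.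
elim: k => [|k [h0 h1]].
  split; first by rewrite /gegenbauer_at1 big_ord0 scale1r.
  by rewrite gegenbauer_at1S /gegenbauer_at1 big_ord0 mul1r addr0 divr1.
split=> //; rewrite -[LHS]/(k.+2%:R^-1 *: ((2 * (k.+1%:R + a)) *: ('X * gegenbauer a
  k.+1)
   - (k%:R + 2 * a) *: gegenbauer a k)) h0 h1 zgegSS.
have n1 : k.+1%:R != 0 :> R by rewrite pnatr_eq0.
have n2 : k.+2%:R != 0 :> R by rewrite pnatr_eq0.
have n3 : k.+1%:R + 2 * a != 0 by rewrite gt_eqF// ltr_pwDl ?ltr0n ?mulr_ge0// ltW.
rewrite !scalerBr -scalerAr !scalerA.
rewrite !gegenbauer_at1S; move: n1 n2 n3; move: (k.+2%:R) (k.+1%:R) => A B n1 n2 n3.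
by congr (_ *: _ - _ *: _); field; rewrite ?n1 ?n2 ?n3.
Qed.

(** The product telescopes with ratio (k + a) / (k + 1 + a), and yields [gamma_coef] for p > 2. The
    cases k = 0 and k = 1 come first because [coef_zgegSS] relates leading coefficients only from
    degree 1 on. *)
Lemma gegenbauer_at1_sqnorm a k : 0 < a ->
  gegenbauer_at1 a k * zgeg_sqnorm a k = a / (k%:R + a).
Proof.
move=> a0; have a1 : 0 <= a := ltW a0; have an0 : a != 0 by rewrite gt_eqF.
have kan j : j%:R + a != 0 by rewrite gt_eqF// ltr_wpDl.
case: k => [|k].
  by rewrite zgeg_sqnormE// /gegenbauer_at1 big_ord0 coefC /= mulr1 gegLXn /= mulr0n
    add0r !mul1r divff.
elim: k => [|k IH].
  rewrite zgeg_sqnormE// gegL_diagS// gegenbauer_at1S /gegenbauer_at1 big_ord0 coefX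
    /= mulr1 gegLXn /=.
  by have := kan 1%N => h; field.
rewrite zgeg_sqnormE// gegL_diagS// gegenbauer_at1S coef_zgegSS//.
have n2 : k.+2%:R != 0 :> R by rewrite pnatr_eq0.
have n3 : k.+1%:R + 2 * a != 0 by rewrite gt_eqF// ltr_pwDl ?ltr0n ?mulr_ge0.
have h1 := kan k.+1; have h2 := kan k.+2.
rewrite zgeg_sqnormE// in IH.
transitivity ((k.+1%:R + a) / (k.+2%:R + a) *
   (gegenbauer_at1 a k.+1 * ((zgeg a k.+1)`_k.+1 * gegL a ('X^(k.+1) * zgeg a k.+1)))).
  move: n2 n3 h1 h2; move: (k.+2%:R) (k.+1%:R) (gegenbauer_at1 _ _) (_`_ _) (gegL _ _).
  by move=> A B w c e n2 n3 h1 h2; field; rewrite ?n2 ?h2 ?n3.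
by rewrite IH; move: h1 h2; move: (k.+2%:R) (k.+1%:R) => A B h1 h2; field;
  rewrite ?h1 ?h2.
Qed.

Lemma chebyshev_sqnorm k : zgeg_sqnorm (0 : R) k.+1 = 2^-1.
Proof.
elim: k => [|k IH].
  by rewrite zgeg_sqnormE// gegL_diagS// coefX /= mulr1 gegLXn /= !(addr0, mul1r,
    mulr1, mulr1n).
rewrite zgeg_sqnormE// gegL_diagS// coef_zgegSS//.
rewrite zgeg_sqnormE// in IH; rewrite -IH.
have n1 : k.+1%:R != 0 :> R by rewrite pnatr_eq0.
have n2 : k.+2%:R != 0 :> R by rewrite pnatr_eq0.
rewrite !mulr0 !addr0; move: n1 n2; move: (k.+2%:R) (k.+1%:R) (_`_ _) (gegL _ _).
by move=> A B c e n1 n2; field; rewrite n1 n2.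
Qed.

(** At a = 0 the recurrence is cos((k+2)x) = 2 cos(x) cos((k+1)x) - cos(kx). *)
Lemma cos_acos_zgeg k u : -1 <= u <= 1 -> cos (k%:R * acos u) = (zgeg 0 k).[u].
Proof.
move=> u1; suff: cos (k%:R * acos u) = (zgeg 0 k).[u] /\
    cos (k.+1%:R * acos u) = (zgeg 0 k.+1).[u] by case.
elim: k => [|k [h0 h1]]; first by rewrite mul0r cos0 hornerC mul1r acosK// hornerX.
split=> //; rewrite zgegSS mulr0 !addr0 !(hornerZ, hornerD, hornerN, hornerM,
  hornerX) -h0 -h1.
have e2 : k.+2%:R * acos u = k.+1%:R * acos u + acos u by rewrite -natr1 mulrDl mul1r.
have e0 : k%:R * acos u = k.+1%:R * acos u - acos u by rewrite -natr1 mulrDl mul1r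
  addrK.
rewrite e2 e0 cosD cosB acosK//.
have n1 : k.+1%:R != 0 :> R by rewrite pnatr_eq0.
by field; rewrite nat1r.
Qed.

End StandardNormalization.

(** * The coefficients of the harmonic decomposition *)

Section HarmonicCoefficients.
Context {R : realType} (p : nat).
Hypothesis p_ge2 : (2 <= p)%N.
Variable lambda : R.
Hypothesis lambda_gt0 : 0 < lambda.
Implicit Types (k : nat) (u : R).
Let a : R := (p%:R - 2) / 2.
Let a_ge0 : 0 <= a := @gegindex_ge0 R p p_ge2.
Let a_gt0 : p != 2%N -> 0 < a.
Proof. by move=> p2; rewrite divr_gt0// subr_gt0 (ltr_nat R 2) ltn_neqAle eq_sym p2.
  Qed.
Let a_p2 : p == 2%N -> a = 0.
Proof. by move/eqP => p2; rewrite /a p2 subrr mul0r. Qed.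
Let mu k : R := @expcoef R p lambda k.

Definition gegC_at1 k : R := if p == 2%N then 1 else gegenbauer_at1 a k.

Lemma gegC_zgeg k u : -1 <= u <= 1 -> gegC p k u = gegC_at1 k * (zgeg a k).[u].
Proof.
move=> u1; rewrite /gegC /gegC_at1; case: ifPn => [/a_p2->|/a_gt0 a0].
  by rewrite mul1r cos_acos_zgeg.
by rewrite gegenbauer_zgegE// hornerZ.
Qed.

Lemma gegC_at1_sqnorm k : gegC_at1 k * zgeg_sqnorm a k = gamma_coef p k.
Proof.
rewrite /gegC_at1 /gamma_coef; case: ifPn => [/a_p2->|/a_gt0 a0].
  rewrite mul1r; case: k => [|k]; last by rewrite chebyshev_sqnorm /= addr0 div1r.
  by rewrite zgeg_sqnormE// coefC /= mulr1 gegLXn /= mul1r divff.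
rewrite gegenbauer_at1_sqnorm//; have ak : k%:R + a != 0 by rewrite gt_eqF// ltr_wpDl.
have e : 2 * k%:R + p%:R - 2 = 2 * (k%:R + a) by rewrite /a; field.
rewrite e (_ : p%:R - 2 = 2 * a); last by rewrite /a; field.
by field; rewrite ?ak.
Qed.

Let gamma_neq0 k : @gamma_coef R p k != 0.
Proof.
rewrite /gamma_coef; case: ifPn => [_|/a_gt0 a0].
  by rewrite mulf_neq0// gt_eqF// ltr_wpDr.
rewrite (_ : p%:R - 2 = 2 * a); last by rewrite /a; field.
have -> : 2 * k%:R + p%:R - 2 = 2 * (k%:R + a) by rewrite /a; field.
by rewrite gt_eqF// divr_gt0// mulr_gt0// ltr_wpDl.
Qed.

Lemma ipL2pE (f g : R -> R) : ipL2p p f g = gegI a (fun u => f u * g u).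
Proof.
apply: eq_Rintegral => u _; rewrite /gegw; congr (_ * _ `^ _).
by rewrite /a; field.
Qed.

Let cZ k : continuous (horner (zgeg a k)).
Proof. exact: continuous_horner. Qed.

Lemma gegI_gegC (f : R -> R) k : continuous f ->
  gegI a (fun u => f u * gegC p k u) = gegC_at1 k * gegI a (fun u =>
    (zgeg a k).[u] * f u).
Proof.
move=> cf; rewrite -gegIZ//; last by apply: mulr_fun_continuous.
apply: eq_Rintegral => u; rewrite inE /= in_itv /= => u1.
by rewrite gegC_zgeg//; ring.
Qed.

Lemma gegI_gegC_sqr k :
  gegI a (fun u => gegC p k u * gegC p k u) =
    gegC_at1 k ^+ 2 * (gegI1 a * zgeg_sqnorm a k).
Proof.
transitivity (gegI a (fun u => gegC_at1 k * (zgeg a k).[u] * gegC p k u)).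
  apply: eq_Rintegral => u; rewrite inE /= in_itv /= => u1.
  by rewrite (gegC_zgeg k u1).
rewrite gegI_gegC; last by apply: mulr_fun_continuous => //; move=> ?;
  exact: cst_continuous.
rewrite /zgeg_sqnorm -gegI_horner// expr2 -mulrA; congr (_ * _).
rewrite -gegIZ//; last exact: continuous_horner.
by congr gegI; apply/funext => u; rewrite hornerM; ring.
Qed.

Lemma m_coefE k : m_coef p k lambda = mu k / gamma_coef p k.
Proof.
have g0 := gamma_neq0 k; rewrite -gegC_at1_sqnorm mulf_eq0 negb_or in g0 *.
case/andP: g0 => w0 h0; have I0 : gegI1 a != 0 by rewrite gt_eqF// gegI1_gt0.
rewrite /m_coef !ipL2pE gegI_gegC_sqr gegI_gegC; last exact: exp_scale_continuous.
have -> : gegI a (fun u => (zgeg a k).[u] * expR (lambda * u)) = gegI1 a * mu k.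
  by rewrite /mu /expcoef mulrC divfK.
move: w0 h0 I0; move: (gegC_at1 k) (zgeg_sqnorm a k) (gegI1 a) (mu k) =>
  w h I m w0 h0 I0.
by field; rewrite w0 h0 I0.
Qed.

Let lap_eigenvalueE k : k%:R * (k%:R + p%:R - 2) = @lap_eigenvalue R p k.
Proof. by rewrite /lap_eigenvalue; congr (_ * _); field. Qed.

Lemma c_coef_gegC k u : -1 <= u <= 1 -> c_coef p k lambda * gegC p k u =
  (@lap_eigenvalue R p k * mu k) ^+ 2 / zgeg_sqnorm a k * (zgeg a k).[u].
Proof.
move=> u1; rewrite gegC_zgeg// /c_coef m_coefE lap_eigenvalueE.
have g0 := gamma_neq0 k; rewrite -gegC_at1_sqnorm mulf_eq0 negb_or in g0 *.
case/andP: g0; move: (gegC_at1 k) (zgeg_sqnorm a k) => w h w0 h0.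
by field; rewrite w0 h0.
Qed.

Lemma expcoef_bessel k : mu k =
  Gamma (a + 1) * (2 / lambda) `^ a * besselI (a + k%:R) lambda.
Proof.
have h := @gegL_expcoef_cvg R p p_ge2 lambda (ltW lambda_gt0) k.
exact: (@expcoef_series R a a_ge0 lambda lambda_gt0 k _ h).
Qed.

Lemma c_coef_bessel k : (1 <= k)%N -> c_coef p k lambda =
  if p == 2%N then 2 * k%:R ^+ 4 * besselI k%:R lambda ^+ 2
  else 2 ^+ (p - 3) * lambda ^- (p - 2) * (p%:R - 2)
       * (k%:R + (p%:R - 2) / 2)
       * (Gamma ((p%:R - 2) / 2) * (k%:R * (k%:R + p%:R - 2))
          * besselI ((p%:R - 2) / 2 + k%:R) lambda) ^+ 2.
Proof.
move=> k1; rewrite /c_coef m_coefE expcoef_bessel -/a /gamma_coef;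
  case: ifPn => [p2|p2].
  rewrite (a_p2 p2) !add0r powRr0 (@Gamma_nat R 0) fact0 !mul1r.
  have -> : p%:R = 2 :> R by rewrite (eqP p2).
  by rewrite addrK gtn_eqF//= addr0; field.
have a0 := a_gt0 p2.
have e1 : p%:R - 2 = 2 * a by rewrite /a; field.
have e2 : 2 * k%:R + p%:R - 2 = 2 * (k%:R + a) by rewrite /a; field.
have e3 : k%:R + p%:R - 2 = k%:R + 2 * a by rewrite /a; field.
have ka : k%:R + a != 0 by rewrite gt_eqF// ltr_wpDl.
have p3 : (2 < p)%N by rewrite ltn_neqAle eq_sym p2.
(* Since 2a = p - 2 this is (2 / lambda)^(p - 2); one factor 2 is split off to match the power p - 3
   in the claim. *)
have e4 : ((2 / lambda) `^ a) ^+ 2 = 2 * 2 ^+ (p - 3) * lambda ^- (p - 2).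
  rewrite -powR_mulrn ?powR_ge0// -powRrM.
  have -> : a * 2%:R = (p - 2)%:R by rewrite natrB// e1 mulrC.
  rewrite powR_mulrn ?divr_ge0 ?(ltW lambda_gt0)// expr_div_n -exprS.
  by congr (2 ^+ _ / _); rewrite -subSn.
rewrite e1 e2 e3 GammaS//.
have an0 : a != 0 by rewrite gt_eqF.
transitivity ((k%:R + a) * a * ((2 / lambda) `^ a) ^+ 2 *
  (Gamma a * (k%:R * (k%:R + 2 * a)) * besselI (a + k%:R) lambda) ^+ 2).
  by move: (besselI _ _) ((2 / lambda) `^ a) (Gamma a) => B L G; field; rewrite ka an0.
by rewrite e4; ring.
Qed.

End HarmonicCoefficients.

(** * The statistic as a double sum *)

Lemma Tstat_smean (R : realType) (p n : nat) (nu : probability (borelRV R p) R)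
    (hnu : uniform_on_sphere nu) (lambda : R) (x : 'I_n -> 'rV[R]_p) :
  (0 < n)%N -> (forall i, sphere R p (x i)) ->
  Tstat nu lambda x = n%:R^-1 * \sum_(i < n) \sum_(j < n)
    smean nu (fun t => lapexp (p := p) lambda (dot (x i) t) * lapexp (p := p) lambda
      (dot (x j) t)).
Proof.
move=> n0 Sx; have cF i : continuous (fun t => lapexp (p := p) lambda (dot (x i) t)).
  by apply: zonal_continuous; exact: lapexp_continuous.
have cFF i j : continuous (fun t =>
  lapexp (p := p) lambda (dot (x i) t) * lapexp (p := p) lambda (dot (x j) t)).
  exact: mulr_fun_continuous.
rewrite /Tstat /sphere_L2norm sqr_sqrtr; last first.
  by apply: Rintegral_ge0 => t _; rewrite -expr2 sqr_ge0.
have -> : sphere_ip nu (fun t => n%:R^-1 * \sum_(j < n) laplace_beltrami (fun y =>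
  expR (lambda * dot t y)) (x j))
    (fun t => n%:R^-1 * \sum_(j < n) laplace_beltrami (fun y =>
      expR (lambda * dot t y)) (x j)) =
  n%:R^-1 ^+ 2 * \sum_(i < n) \sum_(j < n)
    smean nu (fun t => lapexp (p := p) lambda (dot (x i) t) * lapexp (p := p) lambda
      (dot (x j) t)).
  transitivity (smean nu (fun t => n%:R^-1 ^+ 2 * \sum_(i < n) \sum_(j < n)
      (lapexp (p := p) lambda (dot (x i) t) * lapexp (p := p) lambda (dot (x j) t)))).
    apply: eq_smean => t St.
    have -> : \sum_(j < n) laplace_beltrami (fun y => expR (lambda * dot t y)) (x j) =
        \sum_(j < n) lapexp (p := p) lambda (dot (x j) t).
      by apply: eq_bigr => j _; rewrite laplace_beltrami_exp// dotC.
    by rewrite mulrACA -expr2 mulr_suml; congr (_ * _); apply: eq_bigr => i _;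
      rewrite mulr_sumr.
  have cs (F : 'I_n -> 'rV[R]_p -> R) : (forall i, continuous (F i)) ->
      continuous (fun t => \sum_(i < n) F i t).
    by move=> cFi t; apply: (@continuous_big _ _ +%R) => [|i _];
      [exact: add_continuous|exact: cFi].
  have cc := cs _ (fun i => cs _ (cFF i)).
  rewrite (smeanZ nu _ cc) (smean_sum hnu _ (fun i => cs _ (cFF i))); congr (_ * _).
  by apply: eq_bigr => i _; rewrite (smean_sum hnu _ (cFF i)).
rewrite mulrA; congr (_ * _).
by rewrite expr2 mulrA divff ?mul1r// pnatr_eq0 -lt0n.
Qed.

Theorem lemma2p1 (R : realType) (p : nat) (hp : (2 <= p)%N)
  (lambda : R) (hlambda : 0 < lambda) (n : nat) (hn : (0 < n)%N)
  (nu : probability (borelRV R p) R) (hnu : uniform_on_sphere nu)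
  (d : measure_display) (Omega : measurableType d) (P : probability Omega R)
  (X : 'I_n -> {RV P >-> borelRV R p})
  (hXsphere : forall j w, sphere R p (X j w))
  (hXiid : iid X) :
  (forall w : Omega,
     (forall i j : 'I_n,
        cvgn (fun N : nat => \sum_(1 <= k < N)
          (c_coef p k lambda * gegC p k (dot (X i w) (X j w))))) /\
     Tstat nu lambda (fun j => X j w) =
       n%:R^-1 * \sum_(i < n) \sum_(j < n) \big[+%R/0]_(1 <= k <oo)
         (c_coef p k lambda * gegC p k (dot (X i w) (X j w)))) /\
  (forall k : nat, (1 <= k)%N ->
     c_coef p k lambda =
       if p == 2%N then 2 * k%:R ^+ 4 * besselI k%:R lambda ^+ 2
       else 2 ^+ (p - 3) * lambda ^- (p - 2) * (p%:R - 2)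
            * (k%:R + (p%:R - 2) / 2)
            * (Gamma ((p%:R - 2) / 2) * (k%:R * (k%:R + p%:R - 2))
               * besselI ((p%:R - 2) / 2 + k%:R) lambda) ^+ 2).
Proof.
split; last by move=> k; exact: c_coef_bessel.
move=> w.
have series_cvg i j : \sum_(1 <= k < N) (c_coef p k lambda * gegC p k (dot (X i w) (X
  j w)))
    @[N --> \oo] --> smean nu (fun t => lapexp (p := p) lambda (dot (X i w) t) *
      lapexp (p := p) lambda (dot (X j w) t)).
  have h := smean_lapexp_cvg hp hnu (ltW hlambda) (hXsphere i w) (hXsphere j w).
  move: h; set v := (fun K : nat => _) => h; set s := (fun N : nat => _).
  (* After the shift the full sum has a term k = 0 to split off; it is zero because its eigenvalue
     is. *)
  rewrite -(@cvg_shiftS R v) in h; rewrite -(@cvg_shiftS R s).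
  suff e N : s N.+1 = v N.+1 by rewrite (eq_cvg _ _ e).
  rewrite /s /v -(big_mkord xpredT
    (fun k => (lap_eigenvalue k * expcoef lambda k) ^+ 2 / zgeg_sqnorm ((p%:R - 2) /
      2) k *
       (zgeg ((p%:R - 2) / 2) k).[dot (X i w) (X j w)])).
  rewrite [RHS]big_ltn// [X in X + _](_ : _ = 0) ?add0r; last first.
    by rewrite /lap_eigenvalue mulr0n !mul0r expr0n /= !mul0r.
  by apply: eq_bigr => k _; rewrite c_coef_gegC//; exact: dot_sphere_le1.
split=> [i j|]; first by apply/cvg_ex; eexists; exact: series_cvg.
rewrite Tstat_smean//; congr (_ * _); apply: eq_bigr => i _; apply: eq_bigr => j _.
by rewrite (cvg_lim _ (series_cvg i j)).
Qed.
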